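(* Let $c$ be a positive real number and let $(G_k)$ be a family of finite groups whose orders tend to infinity. Then $c$ is the threshold for diameter 2 for this family if and only if for every $\varepsilon>0$ we have $f_{G_k}(c-\varepsilon) \to \infty$ and $f_{G_k}(c+\varepsilon) \to 0$ as $k \to \infty$.
   Context: For a finite group $G$ and a subset $S \subseteq G$, the Cayley graph $\Gamma(G;S)$ has vertex set $G$ and an edge between distinct $g,h$ if and only if $hg^{-1} \in S$ or $gh^{-1} \in S$ (loops and multiple edges ignored). The random model $\mathcal{G}(G,p)$ is the probability space of graphs $\Gamma(G;S)$ where each element of $G$ is put in $S$ independently with probability $p$. The diameter of a disconnected graph is infinite. For a family $(G_k)$ of finite groups of orders $n_k\to\infty$, a real $c>0$ is the threshold for diameter 2 if for every $\varepsilon>0$, with probability tending to $1$ as $k\to\infty$, $\Gamma \in \mathcal{G}(G_k,p)$ has diameter greater than 2 if $p \leqslant \sqrt{(c-\varepsilon)\frac{\log n_k}{n_k}}$ and diameter at most 2 if $p \geqslant \sqrt{(c+\varepsilon)\frac{\log n_k}{n_k}}$. Dependency graphs: for a finite group $G$ and a non-identity $x \in G$, $\Gamma_x$ is the graph with vertex set $G$ in which $g$ is adjacent to $h$ iff $h \in \{xg, xg^{-1}, x^{-1}g, x^{-1}g^{-1}, gx, gx^{-1}, g^{-1}x, g^{-1}x^{-1}\}$; loops are allowed, multiple edges are ignored. For such a graph $\Gamma$, $\ell(\Gamma)$ is the number of loops and $e(\Gamma)$ the number of edges that are not loops. Write $n=|G|$. Define $g_G(x) = n^{-e(\Gamma_x)/n}$;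 $h_G(x) = \exp\bigl(-\sqrt{\tfrac{\log n}{n}}\,\ell(\Gamma_x)\bigr)$ if $x^2=1$ and $h_G(x) = \exp\bigl(-2\sqrt{\tfrac{\log n}{n}}\,\ell(\Gamma_x)\bigr)$ if $x^2\neq 1$; for $c>0$, $f_G(x;c) = g_G(x)^c h_G(x)^{\sqrt{c}}$ and $f_G(c) = \sum_{x \in G\setminus\{1\}} f_G(x;c)$. *)

(* Defs.v *)
From HB Require Import structures.
From mathcomp Require Import all_boot all_order all_algebra all_fingroup.
From mathcomp Require Import all_classical all_reals all_analysis.

Set Implicit Arguments.
Unset Strict Implicit.
Unset Printing Implicit Defensive.

Import Order.TTheory GRing.Theory Num.Theory.
Import numFieldNormedType.Exports.

Local Open Scope classical_set_scope.
Local Open Scope ring_scope.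

Section Diameter.
Variables (R : realType) (T : finType).

(* The infimum over the empty set is +oo, so vertices in different components
   are at infinite distance. *)
Definition graph_dist (e : rel T) (x y : T) : \bar R :=
  ereal_inf [set (size s)%:R%:E | s in [set s : seq T | path e x s /\ last x s = y]].

Definition diameter (e : rel T) : \bar R :=
  ereal_sup [set graph_dist e xy.1 xy.2 | xy in [set: T * T]].

End Diameter.

Section RandomCayleyGraph.
Variables (R : realType) (G : finGroupType).

Definition cayley_graph (S : {set G}) : rel G :=
  fun g h => (g != h) && (((h * g^-1)%g \in S) || ((g * h^-1)%g \in S)).

(* The law of the random graph is the image, under S |-> cayley_graph S, of the
   product Bernoulli(p) law on subsets S of G; events are predicates on graphs. *)
Definition cayley_prob (p : R) (A : pred (rel G)) : R :=
  \sum_(S : {set G} | A (cayley_graph S))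
    (\prod_(g in S) p) * (\prod_(g in ~: S) (1 - p)).

End RandomCayleyGraph.

(* p ranges over all sequences of probabilities, and the comparison with the
   threshold is only required for large k, because the upper bound may exceed 1
   for small orders. *)
Definition diameter2_threshold (R : realType) (G : nat -> finGroupType) (c : R)
    : Prop :=
  let n k : R := #|G k|%:R in
  forall eps : R, 0 < eps ->
    (eps < c ->
     forall p : nat -> R, (forall k, 0 <= p k <= 1) ->
       (\forall k \near \oo, p k <= Num.sqrt ((c - eps) * (ln (n k) / n k))) ->
       cayley_prob (p k) (fun e : rel (G k) => (2%:E < diameter R e)%E)
         @[k --> \oo] --> (1 : R))
    /\
    (forall p : nat -> R, (forall k, 0 <= p k <= 1) ->
       (\forall k \near \oo, Num.sqrt ((c + eps) * (ln (n k) / n k)) <= p k) ->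
       cayley_prob (p k) (fun e : rel (G k) => (diameter R e <= 2%:E)%E)
         @[k --> \oo] --> (1 : R)).

Section DependencyGraph.
Variables (R : realType) (G : finGroupType).

Definition dependency_graph (x : G) : rel G :=
  fun g h => h \in [:: x * g; x * g^-1; x^-1 * g; x^-1 * g^-1;
                       g * x; g * x^-1; g^-1 * x; g^-1 * x^-1]%g.

Definition loops (e : rel G) : nat := #|[set g | e g g]%SET|.

(* Number of unordered pairs {g, h} of distinct adjacent vertices. *)
Definition nonloop_edges (e : rel G) : nat :=
  #|[set [set gh.1; gh.2]
      | gh in [set gh : G * G | (gh.1 != gh.2) && e gh.1 gh.2]]%SET|.

Let n : R := #|G|%:R.

Definition gG (x : G) : R :=
  n `^ (- ((nonloop_edges (dependency_graph x))%:R / n)).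

Definition hG (x : G) : R :=
  if (x ^+ 2 == 1)%g
  then expR (- (Num.sqrt (ln n / n) * (loops (dependency_graph x))%:R))
  else expR (- (2 * Num.sqrt (ln n / n) * (loops (dependency_graph x))%:R)).

Definition fGx (x : G) (c : R) : R := gG x `^ c * hG x `^ Num.sqrt c.

End DependencyGraph.

Definition fG (R : realType) (G : finGroupType) (c : R) : R :=
  \sum_(x : G | x != 1%g) fGx x c.

(* Main.v *)
(* Put q = sqrt(log n / n) and p = sqrt(c) q. The graph of S has diameter at most 2
   iff every x <> 1 is covered, i.e. lies in T or T T, where T is S together with
   the inverses of its elements. Apart from the requirement that x and x^-1 are not
   in S, x is uncovered iff S is an independent set of the dependency graph of x,
   which has bounded degree, so by the Harris and Janson inequalities this happens
   with probability about exp(- p^2 e - p l), where e and l count the edges and the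
   loops. Changing c by a constant changes the sum W(c) of these quantities by a
   power of n, because e >= n / 2. The first moment method shows that the diameter
   is at most 2 when W(c) tends to 0. When W(c) grows like a power of n, the second
   moment method shows that the diameter exceeds 2: each edge lies in at most eight
   dependency graphs, so all but O(log^2 n) of the y have a dependency graph sharing
   at most n / log^2 n edges with that of x, and for these the events are almost
   independent.

   fG differs from W only in that the loops are counted twice when x^2 <> 1.
   This is harmless: at most n^(1/2) elements x have enough loops for it to matter,
   and counting coincidences among the neighbours of a vertex shows that they
   never dominate the sum at the threshold (see [weight_sum_le1_bound]). *)

Require Import Defs.
From HB Require Import structures.
From mathcomp Require Import all_boot all_order all_algebra all_fingroup.
From mathcomp Require Import all_classical all_reals all_analysis.
From mathcomp Require Import ring lra zify.

Set Implicit Arguments.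
Unset Strict Implicit.
Unset Printing Implicit Defensive.

Import Order.TTheory GRing.Theory Num.Theory.
Import numFieldNormedType.Exports.

Local Open Scope classical_set_scope.
Local Open Scope ring_scope.

(** * Bernoulli product measures on the subsets of a finite set *)

Section ProductMeasure.
Variables (R : realType) (T : finType).
Implicit Types (p : R) (F H : {set T} -> R) (S : {set T}).

Definition weight p S : R := (\prod_(g in S) p) * (\prod_(g in ~: S) (1 - p)).

Definition expectation p F : R := \sum_S weight p S * F S.

Definition antitone F := forall S S', S \subset S' -> F S' <= F S.

(* Averages out the coordinate [g]; the expectation is the composition of these
   operators over all [g], which lets product-measure facts be proved one
   coordinate at a time. *)
Definition average p (g : T) F S : R :=
  p * F (g |: S) + (1 - p) * F (S :\ g).

(** Averaging is linear in [F], and [F] is a combination of point masses, so only the folds of point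
    masses remain to be computed. *)
Lemma foldr_average_sum p (s : seq T) (F : {set T} -> R) S0 :
  foldr (average p) F s S0 =
  \sum_S F S * foldr (average p) (fun S' => (S' == S)%:R) s S0.
Proof.
elim: s S0 => [|g s IH] S0 /=.
  rewrite (bigD1 S0) //= eqxx mulr1 big1 ?addr0 // => S /negPf.
  by rewrite eq_sym => ->; rewrite mulr0.
rewrite {1}/average !IH !mulr_sumr -big_split; apply: eq_bigr => S _ /=.
by rewrite /average; ring.
Qed.

(** Coordinates in [s] are resampled, each giving a factor [p] or [1 - p]; the others stay frozen at
    [S0] and must already agree with [S]. *)
Lemma foldr_average_delta p (s : seq T) S S0 : uniq s ->
  foldr (average p) (fun S' => (S' == S)%:R) s S0 =
  (\prod_(g <- s) (if g \in S then p else 1 - p)) *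
  [forall g, (g \notin s) ==> ((g \in S0) == (g \in S))]%:R.
Proof.
elim: s S0 => [|g s IH] S0 /=.
  rewrite big_nil mul1r => _; congr (_%:R); congr (nat_of_bool _).
  apply/eqP/forallP => [-> x|eqS]; first by rewrite /= eqxx.
  by apply/setP => x; apply/eqP; have := eqS x.
case/andP=> gs us; rewrite /average !IH // big_cons.
have E1 : [forall h, (h \notin s) ==> ((h \in g |: S0) == (h \in S))] =
   (g \in S) && [forall h, (h \notin g :: s) ==> ((h \in S0) == (h \in S))].
  apply/forallP/andP => [A|[gS /forallP A] h].
    have gS : g \in S by have := A g; rewrite gs /= !inE eqxx /= => /eqP <-.
    split=> //; apply/forallP => h; have := A h; rewrite !inE.
    by case: (eqVneq h g) => //= ->; rewrite gs.
  have := A h; rewrite !inE; case: (eqVneq h g) => [->|] //= _.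
  by rewrite gS eqxx implybT.
have E0 : [forall h, (h \notin s) ==> ((h \in S0 :\ g) == (h \in S))] =
   (g \notin S) && [forall h, (h \notin g :: s) ==> ((h \in S0) == (h \in S))].
  apply/forallP/andP => [A|[gS /forallP A] h].
    have gS : g \notin S by have := A g; rewrite gs /= !inE eqxx /= => /eqP <-.
    split=> //; apply/forallP => h; have := A h; rewrite !inE.
    by case: (eqVneq h g) => //= ->; rewrite gs.
  have := A h; rewrite !inE; case: (eqVneq h g) => [->|] //= _.
  by rewrite (negPf gS) eqxx implybT.
by rewrite E1 E0; case: (g \in S) => /=; ring.
Qed.

Lemma weight_prod p S :
  weight p S = \prod_g (if g \in S then p else 1 - p).
Proof.
rewrite /weight [RHS](bigID (fun g => g \in S)) /=; congr (_ * _).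
  by apply: eq_bigr => g ->.
by apply: eq_big => [g|g /[!inE] /negPf ->//]; rewrite inE.
Qed.

Lemma expectation_foldr p F (s : seq T) S0 : uniq s -> (forall g, g \in s) ->
  expectation p F = foldr (average p) F s S0.
Proof.
move=> us alls; rewrite foldr_average_sum; apply: eq_bigr => S _.
rewrite foldr_average_delta // [LHS]mulrC; congr *%R.
rewrite weight_prod.
have -> : [forall g, (g \notin s) ==> ((g \in S0) == (g \in S))].
  by apply/forallP => g; rewrite alls.
rewrite mulr1 -(big_enum _ _ _ _) /=; apply: perm_big.
by apply: uniq_perm => // [|g]; rewrite ?enum_uniq // alls mem_enum.
Qed.

Lemma expectation_average p g F :
  expectation p (average p g F) = expectation p F.
Proof.
(* The order of averaging is free, so [g] is put last in the list, where [foldr] applies its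
   operator first; averaging twice over [g] is the same as once. *)
pose s := rcons (rem g (enum T)) g.
have us : uniq s by rewrite rcons_uniq mem_rem_uniqF ?enum_uniq // rem_uniq ?enum_uniq.
have alls h : h \in s.
  by rewrite mem_rcons inE mem_rem_uniq ?enum_uniq // !inE mem_enum andbT orbN.
rewrite !(expectation_foldr _ _ finset.set0 us alls) !foldr_rcons.
congr (foldr _ _ _ _); apply/funext => S; rewrite /average.
have -> : g |: (g |: S) = g |: S by apply/setP => h; rewrite !inE; case: eqP.
have -> : (g |: S) :\ g = S :\ g by apply/setP => h; rewrite !inE; case: eqP.
have -> : g |: (S :\ g) = g |: S by apply/setP => h; rewrite !inE; case: eqP.
have -> : (S :\ g) :\ g = S :\ g by apply/setP => h; rewrite !inE; case: eqP.
by ring.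
Qed.

Lemma expectation1 p : expectation p (fun=> 1) = 1.
Proof.
have a s S : foldr (average p) (fun=> 1) s S = 1.
  by elim: s S => //= g s IH S; rewrite /average !IH; ring.
by rewrite (@expectation_foldr p _ (enum T) finset.set0) ?enum_uniq // => g; rewrite mem_enum.
Qed.

Lemma expectationD p F H :
  expectation p (fun S => F S + H S) = expectation p F + expectation p H.
Proof. by rewrite -big_split /=; apply: eq_bigr => S _; rewrite mulrDr. Qed.

Lemma expectationZ p a F :
  expectation p (fun S => a * F S) = a * expectation p F.
Proof. by rewrite mulr_sumr; apply: eq_bigr => S _; rewrite mulrCA. Qed.

Lemma expectationB p F H :
  expectation p (fun S => F S - H S) = expectation p F - expectation p H.
Proof.
by rewrite -sumrB /=; apply: eq_bigr => S _; rewrite mulrBr.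
Qed.

Lemma expectation_sum p (I : Type) (r : seq I) (P : pred I) (F : I -> {set T} -> R) :
  expectation p (fun S => \sum_(i <- r | P i) F i S) =
  \sum_(i <- r | P i) expectation p (F i).
Proof.
by rewrite exchange_big /=; apply: eq_bigr => S _; rewrite mulr_sumr.
Qed.

Lemma weight_ge0 p S : 0 <= p <= 1 -> 0 <= weight p S.
Proof.
move=> /andP[p0 p1]; rewrite weight_prod prodr_ge0 // => g _.
by case: ifP => // _; rewrite subr_ge0.
Qed.

Lemma ler_expectation p F H : 0 <= p <= 1 -> (forall S, F S <= H S) ->
  expectation p F <= expectation p H.
Proof.
by move=> p01 FH; apply: ler_sum => S _; rewrite ler_wpM2l // weight_ge0.
Qed.

Lemma expectation_ge0 p F : 0 <= p <= 1 -> (forall S, 0 <= F S) ->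
  0 <= expectation p F.
Proof.
by move=> p01 F0; apply: sumr_ge0 => S _; rewrite mulr_ge0 // weight_ge0.
Qed.

Lemma ler_average p g F H S : 0 <= p <= 1 -> (forall S, F S <= H S) ->
  average p g F S <= average p g H S.
Proof.
by move=> /andP[p0 p1] FH; rewrite lerD // ler_wpM2l // subr_ge0.
Qed.

Lemma average_antitone p g F : 0 <= p <= 1 -> antitone F -> antitone (average p g F).
Proof.
move=> /andP[p0 p1] aF S S' SS'.
by rewrite lerD // ler_wpM2l ?subr_ge0 // aF // ?finset.setUS // finset.setSD.
Qed.

Lemma foldr_average_antitone p s F : 0 <= p <= 1 -> antitone F ->
  antitone (foldr (average p) F s).
Proof. by move=> p01 aF; elim: s => //= g s IH; apply: average_antitone. Qed.

(** Induction on the coordinates. For a single coordinate the gap between the two sides is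
    [p * (1 - p)] times the product of the drops of the two functions when [g] joins the set, and
    both drops are nonnegative. *)
Lemma harris p F H : 0 <= p <= 1 -> antitone F -> antitone H ->
  expectation p F * expectation p H <= expectation p (fun S => F S * H S).
Proof.
move=> p01 aF aH.
have us := enum_uniq T; have alls g : g \in enum T by rewrite mem_enum.
rewrite !(expectation_foldr p _ finset.set0 us alls).
elim: (enum T) finset.set0 => //= g s IH S.
apply: le_trans (ler_average g S p01 IH); rewrite /average.
have := foldr_average_antitone s p01 aF; have := foldr_average_antitone s p01 aH.
set F' := foldr _ F s; set H' := foldr _ H s => aH' aF'.
have sub : S :\ g \subset g |: S by rewrite finset.subDset finset.setUA finset.setUid finset.subsetUr.
have {}aF' := aF' _ _ sub; have {}aH' := aH' _ _ sub.
rewrite -subr_ge0.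
have -> : p * (F' (g |: S) * H' (g |: S)) + (1 - p) * (F' (S :\ g) * H' (S :\ g)) -
  (p * F' (g |: S) + (1 - p) * F' (S :\ g)) *
  (p * H' (g |: S) + (1 - p) * H' (S :\ g)) =
  p * (1 - p) * ((F' (S :\ g) - F' (g |: S)) * (H' (S :\ g) - H' (g |: S))) by ring.
by case/andP: p01 => p0 p1; rewrite !mulr_ge0 // subr_ge0.
Qed.

(** At each coordinate, raising [p] to [p'] moves mass [p' - p] from the larger value of [F] to the
    smaller one. *)
Lemma expectation_antitone p p' F : 0 <= p -> p <= p' -> p' <= 1 -> antitone F ->
  expectation p' F <= expectation p F.
Proof.
move=> p0 pp' p'1 aF.
have p01 : 0 <= p <= 1 by rewrite p0 (le_trans pp').
have p'01 : 0 <= p' <= 1 by rewrite p'1 (le_trans p0).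
have us := enum_uniq T; have alls g : g \in enum T by rewrite mem_enum.
rewrite !(expectation_foldr _ _ finset.set0 us alls).
elim: (enum T) finset.set0 => //= g s IH S.
apply: le_trans (ler_average g S p01 IH); rewrite /average.
have := foldr_average_antitone s p'01 aF; set F' := foldr _ F s => aF'.
have sub : S :\ g \subset g |: S by rewrite finset.subDset finset.setUA finset.setUid finset.subsetUr.
have {}aF' := aF' _ _ sub.
rewrite -subr_ge0.
rewrite [X in 0 <= X](_ : _ = (p' - p) * (F' (S :\ g) - F' (g |: S))); last by ring.
by rewrite mulr_ge0 // subr_ge0.
Qed.

(** Conditioning on [A \subset S]: the elements of [A] are forced into [S] one at a time, each at
    the price of a factor [p]. *)
Lemma expectation_subset p (A : {set T}) F :
  expectation p (fun S => (A \subset S)%:R * F S) =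
  p ^+ #|A| * expectation p (fun S => F (A :|: S)).
Proof.
move: {2}#|A| (erefl #|A|) => m; elim: m A F => [|m IH] A F cA.
  move/eqP: (cA); rewrite cards_eq0 => /eqP ->; rewrite cards0 mul1r.
  by apply: eq_bigr => S _; rewrite finset.sub0set finset.set0U mul1r.
have [g gA] : exists g, g \in A by apply/card_gt0P; rewrite cA.
have cA' : #|A :\ g| = m by move: cA; rewrite (cardsD1 g) gA => -[].
rewrite -(expectation_average p g) cA exprS -mulrA.
have -> : expectation p (fun S => F (A :|: S)) =
    expectation p (fun S => F (g |: (A :\ g :|: S))).
  by apply: eq_bigr => S _; rewrite finset.setUA finset.setD1K.
rewrite -{1}cA' -(IH _ (fun S => F (g |: S)) cA') -expectationZ.
apply: eq_bigr => S _; congr (_ * _); rewrite /average.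
have -> : (A \subset S :\ g) = false.
  by apply/negbTE/subsetPn; exists g; rewrite // !inE eqxx.
by rewrite finset.subDset mul0r mulr0 addr0.
Qed.
End ProductMeasure.

(** * Probability that a random set contains no member of a given family *)

Section Avoidance.
Variables (R : realType) (T : finType).
Implicit Types (p : R) (L : seq {set T}) (S e : {set T}).

Definition avoids L S : bool := all (fun e => ~~ (e \subset S)) L.

Lemma avoids_antitone L : antitone (fun S => (avoids L S)%:R : R).
Proof.
move=> S S' SS'; rewrite ler_nat.
have [/allP aS'|//] := boolP (avoids L S').
suff -> : avoids L S by [].
by apply/allP => e eL; apply: contra (aS' e eL) => /fintype.subset_trans; apply.
Qed.

(** Avoiding a single set is a decreasing event, so by [harris] these events are positively
    correlated. *)
Lemma expectation_avoids_ge p L : 0 <= p <= 1 ->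
  \prod_(e <- L) (1 - p ^+ #|e|) <= expectation p (fun S => (avoids L S)%:R).
Proof.
move=> p01; elim: L => [|e L IH].
  by rewrite big_nil expectation1.
rewrite big_cons.
have -> : (fun S => (avoids (e :: L) S)%:R : R) =
    (fun S => (avoids [:: e] S)%:R * (avoids L S)%:R).
  by apply/funext => S; rewrite /avoids /= andbT -natrM mulnb.
apply: le_trans (harris p01 (@avoids_antitone _) (@avoids_antitone _)).
have -> : expectation p (fun S => (avoids [:: e] S)%:R) = 1 - p ^+ #|e|.
  transitivity (expectation p (fun S => 1 - (e \subset S)%:R * 1)).
    by apply: eq_bigr => S _; rewrite /avoids /= andbT mulr1; case: (_ \subset _); rewrite ?subrr ?subr0.
  by rewrite expectationB expectation_subset !expectation1 mulr1.
rewrite ler_wpM2l // subr_ge0; case/andP: p01 => p0 p1.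
by rewrite exprn_ile1.
Qed.

(* Janson's inequality, with the correlation term bounded separately for each
   forbidden set. *)
Lemma expectation_avoids_le p L (d : {set T} -> R) : 0 <= p <= 1 -> uniq L ->
  (forall e, e \in L -> d e <= 1) ->
  (forall e, e \in L ->
    \sum_(j <- L | (j != e) && ~~ [disjoint j & e]) p ^+ #|j :\: e| <= d e) ->
  expectation p (fun S => (avoids L S)%:R) <=
  \prod_(e <- L) (1 - p ^+ #|e| * (1 - d e)).
Proof.
move=> p01; have /andP[p0 p1] := p01; elim: L => [|e L IH] uL d1 dL.
  by rewrite big_nil expectation1.
move: uL => /= /andP[eL uL].
have {}IH : expectation p (fun S => (avoids L S)%:R) <=
    \prod_(e <- L) (1 - p ^+ #|e| * (1 - d e)).
  apply: IH => // f fL; first by rewrite d1 // inE fL orbT.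
  apply: le_trans (dL f _); last by rewrite inE fL orbT.
  by rewrite big_cons; case: ifP => // _; rewrite lerDr exprn_ge0.
(* Conditioning on [e \subset S] replaces [S] by [e :|: S]. Members of [L] disjoint from [e] do not
   notice this. Any other member [j] costs at most [p ^+ #|j :\: e|] times the probability of
   avoiding [N], because avoidance is decreasing, and these costs add up to at most a fraction
   [d e]. *)
pose N := [seq j : {set T} <- L | [disjoint j & e]].
have key : (1 - d e) * expectation p (fun S => (avoids L S)%:R) <=
    expectation p (fun S => (avoids L (e :|: S))%:R).
  have LN : expectation p (fun S => (avoids L S)%:R) <=
      expectation p (fun S => (avoids N S)%:R).
    apply: ler_expectation => // S; rewrite ler_nat.
    have [/allP aL|//] := boolP (avoids L S).
    suff -> : avoids N S by [].
    by apply/allP => j; rewrite mem_filter => /andP[_ /aL].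
  have dle : \sum_(j <- L | ~~ [disjoint j & e]) p ^+ #|j :\: e| <= d e.
    apply: le_trans (dL e _); last by rewrite mem_head.
    rewrite big_cons eqxx /= big_seq_cond [leRHS]big_seq_cond.
    rewrite (eq_bigl (fun j => (j \in L) && ((j != e) && ~~ [disjoint j & e]))) //.
    move=> j; case: (boolP (j \in L)) => //= jL.
    by rewrite (_ : j != e) //; apply: contra eL => /eqP <-.
  have d0 : 0 <= 1 - d e by rewrite subr_ge0 d1 // mem_head.
  apply: le_trans (ler_wpM2l d0 LN) _.
  apply: (@le_trans _ _ (expectation p (fun S => (avoids N S)%:R -
    \sum_(j <- L | ~~ [disjoint j & e]) (j :\: e \subset S)%:R * (avoids N S)%:R))).
    rewrite expectationB expectation_sum mulrBl mul1r lerB //.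
    apply: le_trans (ler_wpM2r _ dle); last by apply: expectation_ge0.
    rewrite mulr_suml; apply: ler_sum => j _; rewrite expectation_subset.
    rewrite ler_wpM2l ?exprn_ge0 //; apply: ler_expectation => // S.
    by apply: avoids_antitone; apply: finset.subsetUr.
  apply: ler_expectation => // S.
  have [aN|_] := boolP (avoids N S); last first.
    by rewrite big1 ?subr0 // => j _; rewrite mulr0.
  rewrite lerBlDr.
  have [aL|] := boolP (avoids L (e :|: S)).
    by rewrite lerDl sumr_ge0 // => j _; rewrite mulr_ge0.
  case/allPn => j jL; rewrite negbK => jS.
  have je : ~~ [disjoint j & e].
    apply/negP => je; have /allP/(_ j) := aN; rewrite mem_filter je jL => /(_ isT).
    apply/negP; rewrite negbK; apply/fintype.subsetP => h hj.
    have := fintype.subsetP jS h hj; rewrite inE; case: (boolP (h \in e)) => // he _.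
    by move/pred0P: je => /(_ h) /=; rewrite hj he.
  rewrite add0r (big_rem j jL) /= je subDset jS mulr1 lerDl.
  by rewrite sumr_ge0 // => i _; rewrite mulr_ge0.
have -> : (fun S => (avoids (e :: L) S)%:R : R) =
    (fun S => (avoids L S)%:R - (e \subset S)%:R * (avoids L S)%:R).
  apply/funext => S; rewrite /avoids /=.
  by case: (e \subset S) => /=; rewrite ?mul1r ?subrr ?mul0r ?subr0.
rewrite expectationB expectation_subset big_cons.
set a := expectation p _ in IH key *.
have de : 0 <= d e.
  apply: le_trans (dL e _); rewrite ?mem_head //.
  by apply: sumr_ge0 => j _; rewrite exprn_ge0.
have pe0 : 0 <= p ^+ #|e| by rewrite exprn_ge0.
have pe1 : p ^+ #|e| <= 1 by rewrite exprn_ile1.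
apply: (@le_trans _ _ ((1 - p ^+ #|e| * (1 - d e)) * a)).
  by rewrite mulrBl mul1r lerB // -mulrA ler_wpM2l.
rewrite ler_wpM2l // subr_ge0.
by rewrite -[leRHS]mulr1 ler_pM // ?subr_ge0 ?d1 ?mem_head // lerBlDr lerDl.
Qed.

Implicit Types (V : {set T}) (E : {set {set T}}).

(* [S] is an independent set of the graph with loops at [V] and edges [E]. *)
Definition independent V E S : bool :=
  [disjoint V & S] && [forall e in E, ~~ (e \subset S)].

Lemma independent_antitone V E : antitone (fun S => (independent V E S)%:R : R).
Proof.
move=> S S' SS'; rewrite ler_nat.
have [/andP[dV /forall_inP iE]|//] := boolP (independent V E S').
suff -> : independent V E S by [].
apply/andP; split; first exact: disjointWr dV.
by apply/forall_inP => e /iE; apply: contra => /fintype.subset_trans; apply.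
Qed.

Lemma independentU V V' E E' S :
  independent (V :|: V') (E :|: E') S = independent V E S && independent V' E' S.
Proof.
rewrite /independent.
have -> : [disjoint V :|: V' & S]%B = [disjoint V & S] && [disjoint V' & S].
  by rewrite -!finset.setI_eq0 finset.setIUl finset.setU_eq0.
have -> : [forall e in E :|: E', ~~ (e \subset S)] =
   [forall e in E, ~~ (e \subset S)] && [forall e in E', ~~ (e \subset S)].
  apply/forall_inP/andP => [A|[/forall_inP A /forall_inP B] e].
    by split; apply/forall_inP => e eE; apply: A; rewrite inE eE ?orbT.
  by rewrite inE => /orP[/A|/B].
by rewrite andbACA.
Qed.

Lemma expectation_independent_ge p V E : 0 <= p <= 1 ->
  (forall e, e \in E -> #|e| = 2)%N ->
  (1 - p) ^+ #|V| * (1 - p ^+ 2) ^+ #|E| <=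
  expectation p (fun S => (independent V E S)%:R).
Proof.
move=> p01 E2.
pose L := [seq [set v]%SET | v <- enum V] ++ enum E.
apply: (@le_trans _ _ (expectation p (fun S => (avoids L S)%:R))); last first.
  apply: ler_expectation => // S; rewrite ler_nat.
  have [/allP aL|//] := boolP (avoids L S).
  suff -> : independent V E S by [].
  apply/andP; split.
    apply/pred0P => v /=; apply/negP => /andP[vV vS].
    have := aL [set v]%SET; rewrite mem_cat map_f ?mem_enum // => /(_ isT).
    by rewrite finset.sub1set vS.
  by apply/forall_inP => e eE; apply: aL; rewrite mem_cat mem_enum eE orbT.
apply: le_trans (expectation_avoids_ge _ p01).
rewrite big_cat big_map /= !big_enum /=.
rewrite (eq_bigr (fun=> 1 - p)) => [|v _]; last by rewrite cards1 expr1.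
rewrite [X in _ <= _ * X](eq_bigr (fun=> 1 - p ^+ 2)) => [|e eE]; last by rewrite E2.
by rewrite !prodr_const.
Qed.

Lemma card_meeting_edges (d : nat) E V :
  (forall v, #|[set e in E | v \in e]%SET| <= d)%N ->
  (#|[set e in E | ~~ [disjoint e & V]]%SET| <= d * #|V|)%N.
Proof.
move=> dE.
apply: (@leq_trans (\sum_(v in V) #|[set e in E | v \in e]%SET|)%N); last first.
  by rewrite mulnC -sum_nat_const; apply: leq_sum.
rewrite -sum1_card big_mkcond /=.
under [X in (_ <= X)%N]eq_bigr do rewrite -sum1_card big_mkcond /=.
rewrite exchange_big /=; apply: leq_sum => e _; rewrite inE.
case: ifP => // /andP[eE /pred0Pn[v /= /andP[ve vV]]].
by rewrite (bigD1 v) //= inE eE ve.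
Qed.

(** Janson's inequality with loops as singletons. Edges meeting [V], at most [d * #|V|] of them, are
    discarded so that the singletons are disjoint from all other forbidden sets. A remaining edge
    meets at most [2 * d] edges, [d] at each end, and each edge other than itself has a vertex
    outside it, so the correlation term is at most [2 * d * p]. *)
Lemma expectation_independent_le p V E (d : nat) : 0 <= p ->
  (2 * d)%:R * p <= 1 -> (0 < d)%N ->
  (forall e, e \in E -> #|e| = 2)%N ->
  (forall v, #|[set e in E | v \in e]%SET| <= d)%N ->
  expectation p (fun S => (independent V E S)%:R) <=
  expR (- (p * #|V|%:R +
           p ^+ 2 * (1 - (2 * d)%:R * p) * (#|E|%:R - (d * #|V|)%:R))).
Proof.
move=> p0 dp1 d0 E2 dE.
have p1 : p <= 1.
  apply: le_trans dp1; rewrite -[leLHS]mul1r ler_wpM2r // ler1n muln_gt0.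
  by rewrite d0.
have p01 : 0 <= p <= 1 by rewrite p0.
pose E' := [set e in E | [disjoint e & V]]%SET.
have cE' : (#|E| <= #|E'| + d * #|V|)%N.
  apply: (@leq_trans (#|E'| + #|[set e in E | ~~ [disjoint e & V]]%SET|)%N); last first.
    by rewrite leq_add2l card_meeting_edges.
  rewrite -(cardsID [set e : {set T} | [disjoint e & V]]%SET E) leq_add //.
    by apply: subset_leq_card; apply/fintype.subsetP => e; rewrite !inE.
  by apply: subset_leq_card; apply/fintype.subsetP => e; rewrite !inE andbC.
pose s1 := [seq [set v]%SET | v <- enum V].
pose L := s1 ++ enum E'.
have s1P e : reflect (exists2 v, v \in V & e = [set v]%SET) (e \in s1).
  apply: (iffP mapP) => -[v vV ->]; exists v => //; first by rewrite -mem_enum.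
  by rewrite mem_enum.
pose dd (e : {set T}) : R := if #|e| == 1%N then 0 else (2 * d)%:R * p.
apply: (@le_trans _ _ (expectation p (fun S => (avoids L S)%:R))).
  apply: ler_expectation => // S; rewrite ler_nat.
  have [/andP[dV /forall_inP iE]|//] := boolP (independent V E S).
  suff -> : avoids L S by [].
  apply/allP => e; rewrite mem_cat => /orP[/s1P[v vV ->]|].
    rewrite finset.sub1set; apply/negP => vS; move/pred0P: dV => /(_ v) /=.
    by rewrite vV vS.
  by rewrite mem_enum inE => /andP[eE _]; apply: iE.
apply: (@le_trans _ _ (\prod_(e <- L) (1 - p ^+ #|e| * (1 - dd e)))).
  apply: expectation_avoids_le => //.
  - rewrite cat_uniq enum_uniq andbT map_inj_uniq ?enum_uniq; last exact: finset.set1_inj.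
    apply/hasPn => e; rewrite mem_enum inE => /andP[/E2 e2 _].
    by apply/negP => /s1P[v _ ev]; move: e2; rewrite ev cards1.
  - by move=> e _; rewrite /dd; case: ifP.
  move=> e; rewrite mem_cat => /orP[/s1P[v vV ->]|].
    rewrite /dd cards1 eqxx big_seq_cond big1 // => j /andP[+ /andP[jv]].
    rewrite mem_cat => /orP[/s1P[w wV jw]|].
      by rewrite jw disjoints1 inE negbK => /eqP wv; move: jv; rewrite jw wv eqxx.
    rewrite mem_enum inE => /andP[_ dj]; rewrite disjoint_sym disjoints1 negbK.
    by move=> vj; move/pred0P: dj => /(_ v) /=; rewrite vj vV.
  rewrite mem_enum inE => /andP[eE eV]; rewrite /dd E2 //=.
  rewrite big_cat /= big_seq_cond big1 ?add0r => [|j]; last first.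
    move=> /andP[/s1P[v vV ->]]; rewrite disjoints1 negbK => /andP[_ ve].
    by move/pred0P: eV => /(_ v) /=; rewrite ve vV.
  rewrite big_enum_cond /=.
  apply: (@le_trans _ _ (\sum_(j in [set j in E | ~~ [disjoint j & e]]%SET) p)).
    rewrite big_mkcond [leRHS]big_mkcond; apply: ler_sum => j _; rewrite !inE.
    case: ifP => [/andP[/andP[jE _] /andP[je ne]]|]; last by case: ifP.
    rewrite jE ne /= -[leRHS]expr1 ler_wiXn2l //.
    rewrite card_gt0; apply: contra je; rewrite finset.setD_eq0 => sub.
    by rewrite eqEcard sub E2 // E2.
  rewrite sumr_const -[leLHS]mulr_natl ler_wpM2r // ler_nat mulnC -(E2 e eE).
  by rewrite card_meeting_edges.
rewrite big_cat big_map /= !big_enum /=.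
under eq_bigr do rewrite /dd cards1 eqxx subr0 mulr1 expr1.
under [X in _ * X <= _]eq_bigr => e /[!inE] /andP[eE _] do rewrite /dd E2 //=.
rewrite !prodr_const opprD expRD.
have e1 : (1 - p) ^+ #|V| <= expR (- (p * #|V|%:R)).
  rewrite -mulNr expRM_natr lerXn2r ?nnegrE ?expR_ge0 ?subr_ge0 //.
  exact: expR_ge1Dx.
set a := p ^+ 2 * _.
have a0 : 0 <= a by rewrite mulr_ge0 ?exprn_ge0 // subr_ge0.
have a1 : a <= 1.
  rewrite -[leRHS]mulr1 ler_pM ?exprn_ge0 ?subr_ge0 ?exprn_ile1 //.
  by rewrite lerBlDr lerDl mulr_ge0.
have e2 : (1 - a) ^+ #|E'| <= expR (- (a * (#|E|%:R - (d * #|V|)%:R))).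
  apply: (@le_trans _ _ (expR (- (a * #|E'|%:R)))).
    rewrite -[in leRHS]mulNr expRM_natr lerXn2r ?nnegrE ?expR_ge0 ?subr_ge0 //.
    exact: expR_ge1Dx.
  rewrite ler_expR lerN2 ler_wpM2l // lerBlDr -natrD ler_nat.
  exact: cE'.
by rewrite ler_pM ?exprn_ge0 ?subr_ge0.
Qed.
End Avoidance.

(** * Edges and degrees of a finite graph *)

Section SimpleGraph.
Variables (T : finGroupType) (e : rel T).

(** The cardinality is convertible with [nonloop_edges e], and later proofs switch between the two
    forms. *)
Definition edge_set : {set {set T}} :=
  [set [set gh.1; gh.2] | gh in [set gh : T * T | (gh.1 != gh.2) && e gh.1 gh.2]]%SET.

Lemma edge_setP (E : {set T}) :
  reflect (exists g h, [/\ g != h, e g h & E = [set g; h]%SET]) (E \in edge_set).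
Proof.
apply: (iffP imsetP) => [[[g h]]|[g [h [gh egh ->]]]].
  by rewrite inE /= => /andP[gh egh] ->; exists g, h.
by exists (g, h) => //; rewrite inE gh.
Qed.

Lemma card_edge E : E \in edge_set -> #|E| = 2%N.
Proof. by case/edge_setP => g [h [gh _ ->]]; rewrite cards2 gh. Qed.

Hypothesis e_sym : symmetric e.

Lemma edges_at (v : T) :
  [set E in edge_set | v \in E]%SET =
  [set [set v; h] | h in [set h | (h != v) && e v h]]%SET.
Proof.
apply/setP => E; rewrite inE; apply/andP/imsetP => [[/edge_setP[g [h [gh egh ->]]]]|[h]].
  rewrite !inE => /orP[]/eqP ->.
    by exists h => //; rewrite inE eq_sym gh.
  by exists g; rewrite ?inE ?gh 1?e_sym //= finset.setUC.
rewrite inE => /andP[hv evh] ->; split; last by rewrite !inE eqxx.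
by apply/edge_setP; exists v, h; rewrite eq_sym.
Qed.

Lemma card_edges_at (v : T) :
  #|[set E in edge_set | v \in E]%SET| = #|[set h | (h != v) && e v h]%SET|.
Proof.
rewrite edges_at card_in_imset // => h h'; rewrite !inE => /andP[hv _] /andP[h'v _].
move/setP => /(_ h); rewrite !inE eqxx (negPf hv) /= => /esym/eqP; exact.
Qed.

(** Handshake lemma, by counting incident pairs of a vertex and an edge in two ways. *)
Lemma sum_degree :
  (\sum_v #|[set h | (h != v) && e v h]%SET| = 2 * nonloop_edges e)%N.
Proof.
under eq_bigr do rewrite -card_edges_at -sum1_card big_mkcond /=.
rewrite exchange_big /= -[nonloop_edges e]/(#|edge_set|) mulnC -sum_nat_const.
rewrite [RHS]big_mkcond /=; apply: eq_bigr => E _; rewrite -big_mkcond /=.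
case: ifP => EE; last by rewrite big1 // => v; rewrite inE EE.
rewrite -(card_edge EE) -sum1_card; apply: eq_bigl => v.
by rewrite inE EE.
Qed.

End SimpleGraph.

(** * Combinatorics of dependency graphs *)

Section DependencyGraphs.
Variable G : finGroupType.
Implicit Types (x y g h : G) (S : {set G}).
Local Notation dep := (@dependency_graph G).

Ltac group_simpl := rewrite ?(invMg, invgK, mulgA, mulgK, mulgKV, mulVg, mulgV, mul1g, mulg1).

Lemma sqE g : (g ^+ 2 = g * g)%g.
Proof. by []. Qed.

(** Solving the adjacency conditions for [x] shows that a given pair is adjacent in the graphs of at
    most eight elements, which limits the overlap of different dependency graphs. *)
Lemma dependencyE x g h : dep x g h =
  (x \in [:: h * g^-1; h * g; g * h^-1; g^-1 * h^-1;
             g^-1 * h; h^-1 * g; g * h; h^-1 * g^-1]%g).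
Proof.
rewrite /dependency_graph !inE.
have -> : (h == x * g)%g = (x == h * g^-1)%g by apply/eqP/eqP => ->; group_simpl.
have -> : (h == x * g^-1)%g = (x == h * g)%g by apply/eqP/eqP => ->; group_simpl.
have -> : (h == x^-1 * g)%g = (x == g * h^-1)%g by apply/eqP/eqP => ->; group_simpl.
have -> : (h == x^-1 * g^-1)%g = (x == g^-1 * h^-1)%g by apply/eqP/eqP => ->; group_simpl.
have -> : (h == g * x)%g = (x == g^-1 * h)%g by apply/eqP/eqP => ->; group_simpl.
have -> : (h == g * x^-1)%g = (x == h^-1 * g)%g by apply/eqP/eqP => ->; group_simpl.
have -> : (h == g^-1 * x)%g = (x == g * h)%g by apply/eqP/eqP => ->; group_simpl.
have -> : (h == g^-1 * x^-1)%g = (x == h^-1 * g^-1)%g by apply/eqP/eqP => ->; group_simpl.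
by [].
Qed.

Lemma dependency_sym x : symmetric (dep x).
Proof.
move=> g h; rewrite !dependencyE !inE.
by do ![case: eqP => _; rewrite /= ?orbT //].
Qed.

Lemma dependencyV x : dep x^-1%g =2 dep x.
Proof.
move=> g h; rewrite /dependency_graph invgK !inE.
by do ![case: eqP => _; rewrite /= ?orbT //].
Qed.

(** For [h = g] four of the eight words collapse to [1], and the other four to [g ^+ 2] or its
    inverse. *)
Lemma dependency_loop x g : x != 1%g ->
  dep x g g = (g ^+ 2 == x)%g || (g ^+ 2 == x^-1)%g.
Proof.
move=> x1; rewrite dependencyE !inE sqE mulgV mulVg (negPf x1).
have -> : (g * g == x^-1)%g = (x == g^-1 * g^-1)%g.
  by apply/eqP/eqP => [E|->]; [rewrite -invMg E invgK | group_simpl].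
rewrite (eq_sym _ x).
by do ![case: eqP => _; rewrite /= ?orbT //].
Qed.

Definition loop_set x : {set G} := [set g | dep x g g]%SET.
Local Notation edges x := (edge_set (dep x)).

Lemma edge_setV x : edges x^-1%g = edges x.
Proof.
apply/setP => E; apply/edge_setP/edge_setP => -[g [h [gh egh ->]]]; exists g, h;
  by split=> //; rewrite ?dependencyV // -dependencyV.
Qed.

Lemma disjoint_loop_set x y : x != 1%g -> y != 1%g -> y != x -> y != x^-1%g ->
  [disjoint loop_set x & loop_set y]%B.
Proof.
move=> x1 y1 yx yx'; apply/pred0P => g /=; rewrite !inE !dependency_loop //.
apply/negP => /andP[/orP[]/eqP -> /orP[]/eqP xy].
- by rewrite xy eqxx in yx.
- by rewrite xy invgK eqxx in yx'.
- by rewrite xy eqxx in yx'.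
- by rewrite (invg_inj xy) eqxx in yx.
Qed.

Lemma card_neighbours x g : (#|[set h | dep x g h]%SET| <= 8)%N.
Proof.
apply: leq_trans (card_size [:: x * g; x * g^-1; x^-1 * g; x^-1 * g^-1;
   g * x; g * x^-1; g^-1 * x; g^-1 * x^-1]%g).
by apply: subset_leq_card; apply/fintype.subsetP => h; rewrite inE.
Qed.

Lemma card_degree x v : (#|[set E in edges x | v \in E]%SET| <= 8)%N.
Proof.
rewrite card_edges_at; last exact: dependency_sym.
apply: leq_trans (card_neighbours x v); apply: subset_leq_card.
by apply/fintype.subsetP => h; rewrite !inE => /andP[].
Qed.

Lemma sum_neighbours x :
  (\sum_g #|[set h | dep x g h]%SET| =
   2 * nonloop_edges (dep x) + loops (dep x))%N.
Proof.
rewrite -sum_degree; last exact: dependency_sym.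
rewrite /loops -sum1_card [X in (_ + X)%N]big_mkcond -big_split /=.
apply: eq_bigr => g _; rewrite (cardsD1 g) !inE addnC; congr (_ + _)%N.
by apply: eq_card => h; rewrite !inE.
Qed.

Lemma leq_nonloop_edges x : x != 1%g -> (#|G| <= 2 * nonloop_edges (dep x))%N.
Proof.
move=> x1; rewrite -sum_degree; last exact: dependency_sym.
rewrite -sum1_card; apply: leq_sum => g _; rewrite card_gt0.
apply/finset.set0Pn; exists (x * g)%g.
by rewrite !inE /dependency_graph !inE eqxx andbT -{2}[g]mul1g (inj_eq (mulIg g)).
Qed.

Definition square_roots y : nat := #|[set g : G | (g ^+ 2)%g == y]%SET|.

Lemma square_rootsV y : square_roots y^-1%g = square_roots y.
Proof.
rewrite /square_roots -(card_imset _ (@invg_inj G)); apply: eq_card => g.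
rewrite inE; apply/imsetP/eqP => [[h]|gy].
  by rewrite inE => /eqP hy ->; rewrite expgVn hy invgK.
by exists g^-1%g; rewrite ?invgK // inE expgVn gy.
Qed.

Lemma sum_square y : (\sum_g ((g ^+ 2)%g == y) = square_roots y)%N.
Proof.
rewrite /square_roots -sum1_card [RHS]big_mkcond /=; apply: eq_bigr => g _.
by rewrite inE; case: eqP.
Qed.

(** Among the four products of [x] or [x^-1] on the left with [g] or [g^-1] on the right,
    coincidences occur only when [g ^+ 2] is [1], [x ^+ 2] or the inverse of [x ^+ 2]. The first
    case costs two neighbours, each of the others one. *)
Lemma card_neighbours_ge x g : (x ^+ 2 != 1)%g ->
  (4 <= #|[set h | dep x g h]%SET| + 2 * ((g ^+ 2)%g == 1%g) +
        ((g ^+ 2)%g == (x ^+ 2)%g) + ((g ^+ 2)%g == (x ^+ 2)^-1%g))%N.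
Proof.
move=> x2.
have sub (s : seq G) : uniq s ->
    {subset s <= [:: x * g; x * g^-1; x^-1 * g; x^-1 * g^-1]%g} ->
    (size s <= #|[set h | dep x g h]%SET|)%N.
  move=> us ss; rewrite -(card_uniqP us); apply: subset_leq_card.
  apply/fintype.subsetP => h /ss; rewrite inE /dependency_graph !inE.
  by case/or4P => ->; rewrite ?orbT.
have xx' a : (x * a == x^-1 * a)%g = false.
  apply/negbTE; apply: contra x2; rewrite (inj_eq (mulIg a)) => /eqP xV.
  by rewrite sqE {1}xV mulVg.
have gg' a : (a * g == a * g^-1)%g = ((g ^+ 2)%g == 1%g).
  rewrite (inj_eq (mulgI a)) sqE.
  by apply/eqP/eqP => [{1}->|/(canRL (mulgK g))]; rewrite ?mulVg ?mul1g.
have [g1|g1] := eqVneq (g ^+ 2)%g 1%g.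
  have := sub [:: x * g; x^-1 * g]%g; rewrite /= inE xx' => /(_ isT).
  have S : {subset [:: x * g; x^-1 * g]%g <=
      [:: x * g; x * g^-1; x^-1 * g; x^-1 * g^-1]%g}.
    by move=> h; rewrite !inE => /orP[] ->; rewrite ?orbT.
  by move=> /(_ S); lia.
have D1 : (x * g == x^-1 * g^-1)%g = ((g ^+ 2)%g == (x ^+ 2)^-1%g).
  rewrite !sqE; apply/eqP/eqP => [E|E].
    have -> : (g * g = x^-1 * (x * g) * g)%g by group_simpl.
    by rewrite E; group_simpl.
  have -> : (x * g = x * (g * g) * g^-1)%g by group_simpl.
  by rewrite E; group_simpl.
have D2 : (x * g^-1 == x^-1 * g)%g = ((g ^+ 2)%g == (x ^+ 2)%g).
  rewrite !sqE; apply/eqP/eqP => [E|E].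
    have -> : (g * g = x * (x^-1 * g) * g)%g by group_simpl.
    by rewrite -E; group_simpl.
  have -> : (x^-1 * g = x^-1 * (g * g) * g^-1)%g by group_simpl.
  by rewrite E; group_simpl.
have [g2|g2] := eqVneq (g ^+ 2)%g (x ^+ 2)%g; last first.
  have [g3|g3] := eqVneq (g ^+ 2)%g (x ^+ 2)^-1%g.
    have := sub [:: x * g; x * g^-1; x^-1 * g]%g.
    rewrite /= !inE xx' gg' D2 (negPf g1) (negPf g2) /= => /(_ isT).
    have S : {subset [:: x * g; x * g^-1; x^-1 * g]%g <=
        [:: x * g; x * g^-1; x^-1 * g; x^-1 * g^-1]%g}.
      by move=> h; rewrite !inE => /or3P[] ->; rewrite ?orbT.
    by move=> /(_ S); lia.
  have := sub [:: x * g; x * g^-1; x^-1 * g; x^-1 * g^-1]%g.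
  rewrite /= !inE !xx' !gg' D2 D1 (negPf g1) (negPf g2) (negPf g3) /= => /(_ isT).
  by move=> /(_ (fun=> id)); lia.
have [g3|g3] := eqVneq (g ^+ 2)%g (x ^+ 2)^-1%g.
  have := sub [:: x * g; x^-1 * g]%g; rewrite /= inE xx' => /(_ isT).
  have S : {subset [:: x * g; x^-1 * g]%g <=
      [:: x * g; x * g^-1; x^-1 * g; x^-1 * g^-1]%g}.
    by move=> h; rewrite !inE => /orP[] ->; rewrite ?orbT.
  by move=> /(_ S); lia.
have := sub [:: x * g; x * g^-1; x^-1 * g^-1]%g.
rewrite /= !inE !xx' gg' D1 (negPf g1) (negPf g3) /= => /(_ isT).
have S : {subset [:: x * g; x * g^-1; x^-1 * g^-1]%g <=
    [:: x * g; x * g^-1; x^-1 * g; x^-1 * g^-1]%g}.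
  by move=> h; rewrite !inE => /or3P[] ->; rewrite ?orbT.
by move=> /(_ S); lia.
Qed.

Lemma card_neighbours_leq_size (s : seq G) x g :
  {subset [set h | dep x g h]%SET <= s} -> (#|[set h | dep x g h]%SET| <= size s)%N.
Proof.
move=> sub; apply: leq_trans (card_size s); apply: subset_leq_card.
exact/fintype.subsetP.
Qed.

Lemma card_neighbours_le x g :
  (#|[set h | dep x g h]%SET| + 4 * ((g ^+ 2)%g == 1%g) <= 8)%N.
Proof.
have [g1|_] := eqVneq (g ^+ 2)%g 1%g; last by rewrite muln0 addn0 card_neighbours.
have gV : g^-1%g = g by apply/eqP; rewrite eq_invg_mul -sqE g1.
suff : (#|[set h | dep x g h]%SET| <= 4)%N by lia.
apply: (@card_neighbours_leq_size [:: x * g; x^-1 * g; g * x; g * x^-1]%g) => h.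
rewrite inE /dependency_graph gV !inE.
by do ![case: eqP => _; rewrite /= ?orbT //].
Qed.

(** The coincidences of [card_neighbours_ge] occur among the left products and again among the right
    ones, whence the doubled coefficients. *)
Lemma card_neighbours_le_sqrt x g : (x ^+ 2 != 1)%g ->
  (#|[set h | dep x g h]%SET| + 4 * ((g ^+ 2)%g == 1%g) +
   2 * ((g ^+ 2)%g == (x ^+ 2)%g) + 2 * ((g ^+ 2)%g == (x ^+ 2)^-1%g) <= 8)%N.
Proof.
move=> x2; have := card_neighbours_le x g.
have [-> le8|g1 _] := eqVneq (g ^+ 2)%g 1%g.
  by rewrite ![1%g == _]eq_sym invg_eq1 (negPf x2) !muln0 !addn0.
have [g2|g2] := eqVneq (g ^+ 2)%g (x ^+ 2)%g; last first.
  have [g3|_] := eqVneq (g ^+ 2)%g (x ^+ 2)^-1%g; last first.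
    by rewrite !muln0 !addn0 card_neighbours.
  have e1 : (x^-1 * g^-1 = x * g)%g.
    have -> : (x * g = x * g ^+ 2 * g^-1)%g by rewrite sqE; group_simpl.
    by rewrite g3 sqE; group_simpl.
  have e2 : (g^-1 * x^-1 = g * x)%g.
    have -> : (g * x = g^-1 * g ^+ 2 * x)%g by rewrite sqE; group_simpl.
    by rewrite g3 sqE; group_simpl.
  suff : (#|[set h | dep x g h]%SET| <= 6)%N by lia.
  apply: (@card_neighbours_leq_size [:: x * g; x * g^-1; x^-1 * g; g * x; g * x^-1; g^-1 * x]%g) => h.
  rewrite inE /dependency_graph e1 e2 !inE.
  by do ![case: eqP => _; rewrite /= ?orbT //].
have f1 : (x^-1 * g = x * g^-1)%g.
  have -> : (x^-1 * g = x^-1 * g ^+ 2 * g^-1)%g by rewrite sqE; group_simpl.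
  by rewrite g2 sqE; group_simpl.
have f2 : (g * x^-1 = g^-1 * x)%g.
  have -> : (g * x^-1 = g^-1 * g ^+ 2 * x^-1)%g by rewrite sqE; group_simpl.
  by rewrite g2 sqE; group_simpl.
have [g3|_] := eqVneq (g ^+ 2)%g (x ^+ 2)^-1%g; last first.
  suff : (#|[set h | dep x g h]%SET| <= 6)%N by lia.
  apply: (@card_neighbours_leq_size [:: x * g; x * g^-1; x^-1 * g^-1; g * x; g^-1 * x; g^-1 * x^-1]%g) => h.
  rewrite inE /dependency_graph f1 f2 !inE.
  by do ![case: eqP => _; rewrite /= ?orbT //].
have e1 : (x^-1 * g^-1 = x * g)%g.
  have -> : (x * g = x * g ^+ 2 * g^-1)%g by rewrite sqE; group_simpl.
  by rewrite g3 sqE; group_simpl.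
have e2 : (g^-1 * x^-1 = g * x)%g.
  have -> : (g * x = g^-1 * g ^+ 2 * x)%g by rewrite sqE; group_simpl.
  by rewrite g3 sqE; group_simpl.
suff : (#|[set h | dep x g h]%SET| <= 4)%N by lia.
apply: (@card_neighbours_leq_size [:: x * g; x * g^-1; g * x; g^-1 * x]%g) => h.
rewrite inE /dependency_graph e1 e2 f1 f2 !inE.
by do ![case: eqP => _; rewrite /= ?orbT //].
Qed.

Lemma nonloop_edges_ge_sqrt x : (x ^+ 2 != 1)%g ->
  (4 * #|G| <= 2 * nonloop_edges (dep x) + loops (dep x) +
     2 * square_roots (1%g : G) + 2 * square_roots (x ^+ 2)%g)%N.
Proof.
move=> x2; rewrite -sum_neighbours -!sum_square mulnC -sum_nat_const.
have -> : (2 * \sum_g ((g ^+ 2)%g == (x ^+ 2)%g) =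
   \sum_g ((g ^+ 2)%g == (x ^+ 2)%g) + \sum_g ((g ^+ 2)%g == (x ^+ 2)^-1%g))%N.
  by rewrite !sum_square square_rootsV; lia.
rewrite addnA big_distrr /= -!big_split /=.
by apply: leq_sum => g _; apply: card_neighbours_ge.
Qed.

(** The square-root terms match those of [nonloop_edges_ge_sqrt]. Hence every [y] with
    [y ^+ 2 = x ^+ 2] has at most [2 e + l] edges, where [e] and [l] count the edges and loops for
    [x]. *)
Lemma nonloop_edges_le_sqrt x : (x ^+ 2 != 1)%g ->
  (nonloop_edges (dep x) + 2 * square_roots (1%g : G) +
   2 * square_roots (x ^+ 2)%g <= 4 * #|G|)%N.
Proof.
move=> x2.
suff : (2 * nonloop_edges (dep x) + loops (dep x) + 4 * square_roots (1%g : G) +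
   2 * square_roots (x ^+ 2)%g + 2 * square_roots (x ^+ 2)^-1%g <= 8 * #|G|)%N.
  by rewrite square_rootsV; lia.
rewrite -sum_neighbours -!sum_square [(8 * _)%N]mulnC -sum_nat_const.
rewrite !big_distrr /= -!big_split /=.
by apply: leq_sum => g _; apply: card_neighbours_le_sqrt.
Qed.

Lemma nonloop_edges_le x :
  (nonloop_edges (dep x) + 2 * square_roots (1%g : G) <= 4 * #|G|)%N.
Proof.
suff : (2 * nonloop_edges (dep x) + loops (dep x) + 4 * square_roots (1%g : G)
   <= 8 * #|G|)%N by lia.
rewrite -sum_neighbours -!sum_square [(8 * _)%N]mulnC -sum_nat_const.
rewrite !big_distrr /= -!big_split /=.
by apply: leq_sum => g _; apply: card_neighbours_le.
Qed.

(** A loop at [g] forces [x] to be [g ^+ 2] or its inverse, so each [g] is a loop for at most two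
    elements. *)
Lemma sum_loops : (\sum_(x | x != 1%g) loops (dep x) <= 2 * #|G|)%N.
Proof.
have le x : x != 1%g -> (loops (dep x) <= 2 * square_roots x)%N.
  move=> x1; rewrite mul2n -addnn -{2}square_rootsV; apply: leq_trans (leq_card_setU _ _).
  apply: subset_leq_card; apply/fintype.subsetP => g.
  by rewrite !inE dependency_loop.
apply: (@leq_trans (\sum_(x : G | x != 1%g) 2 * square_roots x)%N).
  exact: leq_sum.
rewrite -big_distrr leq_mul2l /=.
apply: (@leq_trans (\sum_x square_roots x)%N); last first.
  under eq_bigr do rewrite -sum_square.
  rewrite exchange_big /= -sum1_card; apply: leq_sum => g _.
  rewrite (bigD1 (g ^+ 2)%g) //= eqxx big1 // => x.
  by rewrite eq_sym => /negPf ->.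
by rewrite [X in (_ <= X)%N](bigID (fun x => x != 1%g)) leq_addr.
Qed.

Lemma sum_common_edges x :
  (\sum_y #|edges x :&: edges y| <= 8 * nonloop_edges (dep x))%N.
Proof.
under eq_bigr do rewrite -sum1_card big_mkcond /=.
rewrite exchange_big /= -[nonloop_edges _]/(#|edges x|) mulnC -sum_nat_const.
rewrite [X in (_ <= X)%N]big_mkcond /=; apply: leq_sum => E _.
case: ifP => EE; last by rewrite big1 // => y _; rewrite inE EE.
have [g [h [gh _ Egh]]] := edge_setP _ _ EE.
rewrite -big_mkcond (eq_bigl (mem [set y | E \in edges y]%SET)) ?sum1_card /=; last first.
  by move=> y; rewrite !inE EE.
apply: leq_trans (card_size [:: h * g^-1; h * g; g * h^-1; g^-1 * h^-1;
             g^-1 * h; h^-1 * g; g * h; h^-1 * g^-1]%g).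
apply: subset_leq_card; apply/fintype.subsetP => y.
rewrite inE => /edge_setP[g' [h' [gh' dgh Egh']]].
rewrite -dependencyE.
have : g' \in [set g; h]%SET by rewrite -Egh Egh' !inE eqxx.
have : h' \in [set g; h]%SET by rewrite -Egh Egh' !inE eqxx orbT.
rewrite !inE => /orP[]/eqP e1 /orP[]/eqP e2; move: gh' dgh; rewrite e1 e2 ?eqxx //.
by rewrite dependency_sym.
Qed.

(* [x] is not a product of at most two elements of [S] and their inverses. *)
Definition uncovered x S : bool :=
  independent (loop_set x :|: [set x; x^-1%g])%SET (edges x) S.

Lemma uncovered_antitone (R : realType) x :
  antitone (fun S => (uncovered x S)%:R : R).
Proof. exact: independent_antitone. Qed.

Definition symmetrized S : {set G} := [set g | (g \in S) || (g^-1%g \in S)]%SET.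

(** A product of two elements of the symmetrized set comes from some [g] and [h] in [S] up to
    inversion, and these are adjacent in the dependency graph; for [g = h] the adjacency is a
    loop. *)
Lemma uncoveredP x S : x != 1%g ->
  reflect (x \in symmetrized S \/ exists a b,
      [/\ a \in symmetrized S, b \in symmetrized S & x = (a * b)%g])
    (~~ uncovered x S).
Proof.
move=> x1.
have prod g h : g \in S -> h \in S -> dep x g h -> exists a b,
    [/\ a \in symmetrized S, b \in symmetrized S & x = (a * b)%g].
  move=> gS hS; rewrite dependencyE.
  have gT : g \in symmetrized S by rewrite inE gS.
  have hT : h \in symmetrized S by rewrite inE hS.
  have g'T : g^-1%g \in symmetrized S by rewrite inE invgK gS orbT.
  have h'T : h^-1%g \in symmetrized S by rewrite inE invgK hS orbT.
  rewrite !inE => /or4P[||| /or4P[||| /orP[]]] /eqP ->;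
    by do 2 eexists; split; last reflexivity.
apply: (iffP negP).
  move=> unc; have [xT|xT] := boolP (x \in symmetrized S); [by left|right].
  apply: contrapT => no; apply: unc; apply/andP; split.
    apply/pred0P => v /=; apply/negP => /andP[+ vS]; rewrite !inE => /orP[vv|].
      by apply: no; apply: prod vv.
    by move=> /orP[]/eqP vx; move: xT vS; rewrite inE vx => /norP[/negP + /negP].
  apply/forall_inP => E /edge_setP[g [h [_ dgh ->]]]; apply/negP => ghS.
  apply: no; apply: (prod g h) => //; apply: (fintype.subsetP ghS);
    by rewrite !inE eqxx ?orbT.
move=> cov /andP[/pred0P dis /forall_inP indep].
have xT : x \notin symmetrized S.
  rewrite inE; apply/norP; split; apply/negP => xS.
    by have := dis x; rewrite /= !inE eqxx orbT xS.
  by have := dis x^-1%g; rewrite /= !inE eqxx !orbT xS.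
case: cov => [|[a [b [aT bT xab]]]]; first exact/negP.
have key g h : g \in S -> h \in S -> dep x g h -> False.
  move=> gS hS dgh; have [gh|gh] := eqVneq g h.
    by rewrite -gh in dgh; have := dis g; rewrite /= !inE dgh gS.
  have := indep [set g; h]%SET; rewrite finset.subUset !finset.sub1set gS hS => /(_ _)/negP.
  by case => //; apply/edge_setP; exists g, h.
move: aT bT; rewrite !inE => /orP[]aS /orP[]bS; apply: (key _ _ aS bS);
  by rewrite dependencyE xab !inE ?invgK eqxx ?orbT.
Qed.

(** * Diameter at most 2 as covering of the non-identity elements *)

Lemma graph_dist_le2 (R : realType) (T : finType) (e : rel T) (u v : T) :
  (graph_dist R e u v <= 2%:E)%E <->
  exists s, [/\ path e u s, last u s = v & (size s <= 2)%N].
Proof.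
split=> [|[s [ps ls ss]]]; last first.
  apply: (@le_trans _ _ (size s)%:R%:E); last by rewrite lee_fin ler_nat.
  by apply: ereal_inf_lbound; exists s.
move=> le2; apply: contrapT => no.
(* Lengths are integers, so without a path of length at most 2 the infimum is at least 3. *)
have : (3%:R%:E <= graph_dist R e u v)%E.
  apply: le_ereal_inf_tmp => _ [s [ps ls] <-]; rewrite lee_fin ler_nat ltnNge.
  by apply/negP => ss; apply: no; exists s.
by move=> /le_trans/(_ le2); rewrite lee_fin ler_nat.
Qed.

Lemma diameter_le2 (R : realType) (T : finType) (e : rel T) :
  (diameter R e <= 2%:E)%E <->
  forall u v, exists s, [/\ path e u s, last u s = v & (size s <= 2)%N].
Proof.
split=> [le2 u v|ex].
  apply/(graph_dist_le2 R); apply: le_trans le2; apply: ereal_sup_ubound.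
  by exists (u, v).
apply: ge_ereal_sup => _ [[u v] _ <-]; exact/graph_dist_le2.
Qed.

Lemma diameter_cayley_graph (R : realType) S :
  (diameter R (cayley_graph S) <= 2%:E)%E = [forall (x | x != 1%g), ~~ uncovered x S].
Proof.
apply/idP/forall_inP => [/diameter_le2 ex x x1|cov].
  apply/uncoveredP => //; have [s [ps ls ss]] := ex 1%g x.
  case: s ps ls ss => [|a [|b []]] //=.
  - by move=> _ x1'; rewrite -x1' eqxx in x1.
  - rewrite andbT /cayley_graph => /andP[_ aS] <- _; left.
    by move: aS; rewrite inE invg1 mulg1 mul1g.
  rewrite andbT /cayley_graph => /andP[/andP[_ aS] /andP[_ bS]] <- _; right.
  exists (b * a^-1)%g, a; rewrite !inE invMg invgK mulgKV; split=> //.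
  by move: aS; rewrite invg1 mulg1 mul1g.
apply/diameter_le2 => g h; have [->|gh] := eqVneq g h; first by exists [::].
have x1 : (h * g^-1 != 1)%g by rewrite -eq_mulgV1 eq_sym.
have adj : (h * g^-1)%g \in symmetrized S -> exists s,
    [/\ path (cayley_graph S) g s, last g s = h & (size s <= 2)%N].
  rewrite inE invMg invgK => xT; exists [:: h]; split=> //=.
  by rewrite andbT /cayley_graph gh xT.
have /(uncoveredP S x1)[//|[a [b [aT bT xab]]]] := cov _ x1.
(* A factor [1] yields no edge, as the Cayley graph has no loops; the other factor then joins [g] to
   [h] directly. *)
have [b1|b1] := eqVneq b 1%g; first by apply: adj; rewrite xab b1 mulg1.
have [a1|a1] := eqVneq a 1%g; first by apply: adj; rewrite xab a1 mul1g.
have hE : h = (a * (b * g))%g by rewrite mulgA -xab mulgKV.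
have step u a' : a' != 1%g -> a' \in symmetrized S -> cayley_graph S u (a' * u)%g.
  move=> a'1; rewrite inE /cayley_graph -{1}[u]mul1g (inj_eq (mulIg u)) eq_sym a'1.
  by rewrite invMg mulgA mulgK mulgV mul1g.
by exists [:: (b * g)%g; h]; split=> //=; rewrite andbT hE !step.
Qed.

Lemma cayley_prob_expectation (R : realType) (p : R) (A : pred (rel G)) :
  cayley_prob p A = expectation p (fun S => (A (cayley_graph S))%:R).
Proof.
rewrite /cayley_prob big_mkcond; apply: eq_bigr => S _ /=.
by case: ifP; rewrite ?mulr1 ?mulr0.
Qed.

Lemma cayley_prob_le2 (R : realType) (p : R) :
  cayley_prob p (fun e : rel G => (diameter R e <= 2%:E)%E) =
  expectation p (fun S => [forall (x | x != 1%g), ~~ uncovered x S]%:R).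
Proof.
rewrite cayley_prob_expectation; apply: eq_bigr => S _.
by rewrite diameter_cayley_graph.
Qed.

Lemma cayley_prob_gt2 (R : realType) (p : R) :
  cayley_prob p (fun e : rel G => (2%:E < diameter R e)%E) =
  1 - cayley_prob p (fun e : rel G => (diameter R e <= 2%:E)%E).
Proof.
apply/eqP; rewrite eq_sym subr_eq !cayley_prob_expectation -expectationD.
rewrite -[eqbLHS](expectation1 G p); apply/eqP/eq_bigr => S _; congr (_ * _).
by rewrite ltNge; case: (_ <= _)%E; rewrite /= ?add0r ?addr0.
Qed.
End DependencyGraphs.

(** * Probabilities of being uncovered, and the moment methods *)

Section UncoveredProbability.
Variables (R : realType) (G : finGroupType).
Implicit Types (x y g h : G) (S : {set G}) (p : R).
Local Notation edges x := (edge_set (dependency_graph x)).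
Local Notation ne x := ((nonloop_edges (dependency_graph x))%:R : R).
Local Notation nl x := ((loops (dependency_graph x))%:R : R).
Local Notation n := (#|G|%:R : R).

(* First-order approximation of the probability that [x] is uncovered. *)
Definition uncovered_weight p x : R := expR (- (p ^+ 2 * ne x + p * nl x)).

Lemma ne_ge x : x != 1%g -> n <= 2 * ne x.
Proof. by move=> x1; rewrite -natrM ler_nat leq_nonloop_edges. Qed.

Lemma ne_le x : ne x <= 4 * n.
Proof.
rewrite -natrM ler_nat; apply: leq_trans (nonloop_edges_le x).
by rewrite leq_addr.
Qed.

Lemma expR_le_1D2x (u : R) : 0 <= u <= 1 / 2 -> expR u <= 1 + 2 * u.
Proof.
move=> u01; have := expR_ge1Dx (- u); rewrite expRN => h.
have e0 := expR_gt0 u.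
have : (1 - u) * expR u <= 1 by rewrite -ler_pdivlMr // div1r.
by nra.
Qed.

(** Apply [1 + v <= expR v] at [v = u / (1 - u)], where the left side is the inverse of [1 - u]. *)
Lemma expR_le_1Bx (u : R) : 0 <= u <= 1 / 2 -> expR (- (u + 2 * u ^+ 2)) <= 1 - u.
Proof.
move=> u01; have v0 : 0 < 1 - u by lra.
have := expR_ge1Dx (u / (1 - u)); have -> : 1 + u / (1 - u) = (1 - u)^-1.
  by field; rewrite gt_eqF.
rewrite -[(1 - u)^-1]div1r ler_pdivrMr // => h.
have le : u / (1 - u) <= u + 2 * u ^+ 2 by rewrite ler_pdivrMr //; nra.
rewrite -ler_expR in le.
rewrite expRN invf_ple ?posrE ?expR_gt0 //.
apply: le_trans le; rewrite -div1r ler_pdivrMr //.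
Qed.

(** Janson's bound for the dependency graph alone, ignoring the condition on [x] and [x^-1]. Its
    degrees are at most 8, whence [16 = 2 * 8]. *)
Lemma uncovered_prob_le p x : 0 <= p -> 16 * p <= 1 ->
  expectation p (fun S => (uncovered x S)%:R) <=
  expR (- ((1 - 16 * p) * (p ^+ 2 * ne x + p * nl x))).
Proof.
move=> p0 p16.
have p01 : 0 <= p <= 1 by lra.
apply: (@le_trans _ _ (expectation p (fun S => (independent (loop_set x) (edges x) S)%:R))).
  apply: ler_expectation => // S; rewrite ler_nat.
  have [/andP[dV iE]|//] := boolP (uncovered x S).
  suff -> : independent (loop_set x) (edges x) S by [].
  by rewrite /independent iE andbT; apply: disjointWl dV; apply: finset.subsetUl.
have := @expectation_independent_le R G p (loop_set x) (edges x) 8 p0.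
move=> /(_ _ isT (@card_edge _ _) (card_degree x)).
rewrite (_ : (2 * 8)%:R = 16) // => /(_ p16) /le_trans; apply.
rewrite ler_expR lerN2 natrM.
rewrite -[#|edges x|%:R]/(ne x) -[#|loop_set x|%:R]/(nl x).
have e0 : 0 <= ne x by [].
have l0 : 0 <= nl x by [].
have pl : 0 <= p ^+ 2 * nl x by rewrite mulr_ge0 ?exprn_ge0.
rewrite -subr_ge0.
(* The slack [16 * p ^+ 2 * nl x] in the loop term pays for the at most [8 * nl x] edges discarded
   at loops. *)
rewrite [X in 0 <= X](_ : _ = (p ^+ 2 * nl x) * (8 + 128 * p)); last by ring.
by rewrite mulr_ge0 //; lra.
Qed.

(** The Harris bound made exponential by [expR_le_1Bx], with [u = p] for vertices and [u = p ^+ 2]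
    for edges. The extra vertices [x] and [x^-1] account for [2 * p + 4 * p ^+ 2]. *)
Lemma uncovered_prob_ge p x : 0 <= p <= 1 / 2 ->
  uncovered_weight p x *
    expR (- (2 * p ^+ 2 * nl x + 2 * p + 4 * p ^+ 2 + 2 * p ^+ 4 * ne x)) <=
  expectation p (fun S => (uncovered x S)%:R).
Proof.
move=> ph; have p01 : 0 <= p <= 1 by lra.
have p2h : 0 <= p ^+ 2 <= 1 / 2 by nra.
apply: le_trans (expectation_independent_ge _ p01 (@card_edge _ _)).
apply: (@le_trans _ _ ((1 - p) ^+ (loops (dependency_graph x) + 2) *
   (1 - p ^+ 2) ^+ nonloop_edges (dependency_graph x))); last first.
  rewrite ler_wpM2r //; first by rewrite exprn_ge0 // subr_ge0; lra.
  apply: ler_wiXn2l; [lra|lra|].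
  apply: leq_trans (leq_card_setU _ _) _; rewrite leq_add2l cards2.
  by case: (_ != _).
rewrite /uncovered_weight -expRD.
have h1 := expR_le_1Bx ph; have h2 := expR_le_1Bx p2h.
have -> : - (p ^+ 2 * ne x + p * nl x) -
     (2 * p ^+ 2 * nl x + 2 * p + 4 * p ^+ 2 + 2 * p ^+ 4 * ne x) =
   (loops (dependency_graph x) + 2)%:R * (- (p + 2 * p ^+ 2)) +
   (nonloop_edges (dependency_graph x))%:R * (- (p ^+ 2 + 2 * (p ^+ 2) ^+ 2)).
  by rewrite natrD; ring.
rewrite expRD !expRM_natl; apply: ler_pM; rewrite ?exprn_ge0 ?expR_ge0 //.
- by apply: lerXn2r => //; rewrite nnegrE ?expR_ge0 //; lra.
- by apply: lerXn2r => //; rewrite nnegrE ?expR_ge0 //; lra.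
Qed.

(** If both are uncovered, [S] is independent in the union of the two dependency graphs, whose
    degrees are at most 16. The loop sets are disjoint since a loop determines its element up to
    inversion; common edges are counted once instead of twice, which gives the first error term. *)
Lemma uncovered_pair_prob_le p x y : 0 <= p -> 32 * p <= 1 ->
  x != 1%g -> y != 1%g -> y != x -> y != x^-1%g ->
  expectation p (fun S => (uncovered x S)%:R * (uncovered y S)%:R) <=
  uncovered_weight p x * uncovered_weight p y *
  expR (p ^+ 2 * #|edges x :&: edges y|%:R + 16 * p ^+ 2 * (nl x + nl y) +
        32 * p ^+ 3 * (ne x + ne y)).
Proof.
move=> p0 p32 x1 y1 yx yx'.
have p01 : 0 <= p <= 1 by lra.
pose V := (loop_set x :|: loop_set y)%SET; pose E := (edges x :|: edges y)%SET.
apply: (@le_trans _ _ (expectation p (fun S => (independent V E S)%:R))).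
  apply: ler_expectation => // S; rewrite -natrM mulnb ler_nat independentU.
  have [/andP[/andP[dV iE] /andP[dV' iE']]|//] := boolP (uncovered x S && uncovered y S).
  rewrite /independent iE iE' !andbT.
  have -> : [disjoint loop_set x & S]%B.
    by apply: disjointWl dV; apply: finset.subsetUl.
  have -> : [disjoint loop_set y & S]%B.
    by apply: disjointWl dV'; apply: finset.subsetUl.
  by [].
have E2 e : e \in E -> #|e| = 2%N by rewrite inE => /orP[]/card_edge.
have dE v : (#|[set e in E | v \in e]%SET| <= 16)%N.
  apply: (@leq_trans (#|[set e in edges x | v \in e]%SET :|:
                       [set e in edges y | v \in e]%SET|)%N).
    apply: subset_leq_card; apply/fintype.subsetP => e; rewrite !inE.
    by case/andP => /orP[] -> ->; rewrite ?orbT.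
  apply: leq_trans (leq_card_setU _ _) _.
  exact: (leq_add (card_degree x v) (card_degree y v)).
have := @expectation_independent_le R G p V E 16 p0.
move=> /(_ _ isT E2 dE); rewrite (_ : (2 * 16)%:R = 32) // => /(_ p32) /le_trans; apply.
have cV : #|V|%:R = nl x + nl y.
  have := cardsUI (loop_set x) (loop_set y).
  have := disjoint_loop_set x1 y1 yx yx'; rewrite -finset.setI_eq0 => /eqP ->.
  by rewrite cards0 addn0 -natrD => ->.
have cE : #|E|%:R = ne x + ne y - #|edges x :&: edges y|%:R.
  by rewrite -natrD -(cardsUI (edges x) (edges y)) natrD addrK.
rewrite natrM cV cE /uncovered_weight -!expRD ler_expR.
have e0 : 0 <= ne x by [].
have e0' : 0 <= ne y by [].
have l0 : 0 <= nl x by [].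
have l0' : 0 <= nl y by [].
have c0 : 0 <= #|edges x :&: edges y|%:R :> R by [].
set cm := #|_ :&: _|%:R in c0 *.
have pl : 0 <= p ^+ 3 * (nl x + nl y) by rewrite mulr_ge0 ?exprn_ge0 ?addr_ge0.
have pc : 0 <= p ^+ 3 * cm by rewrite mulr_ge0 ?exprn_ge0.
rewrite -subr_ge0.
rewrite [X in 0 <= X](_ : _ = 32 * (p ^+ 3 * cm) + 512 * (p ^+ 3 * (nl x + nl y))); last by ring.
exact: (addr_ge0 (mulr_ge0 (ler0n _ _) pc) (mulr_ge0 (ler0n _ _) pl)).
Qed.

Lemma union_bound p : 0 <= p <= 1 ->
  1 - expectation p (fun S => [forall (x | x != 1%g), ~~ uncovered x S]%:R) <=
  \sum_(x : G | x != 1%g) expectation p (fun S => (uncovered x S)%:R).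
Proof.
move=> p01; rewrite -[X in X - _](expectation1 G p) -expectationB.
rewrite -(expectation_sum p _ _ (fun x S => (uncovered x S)%:R)).
apply: ler_expectation => // S.
have [_|] := boolP [forall (x | x != 1%g), ~~ uncovered x S].
  by rewrite subrr sumr_ge0.
rewrite negb_forall => /existsP[x]; rewrite negb_imply negbK => /andP[x1 ux].
by rewrite subr0 (bigD1 x) //= ux lerDl sumr_ge0.
Qed.

(* Chebyshev, in the form 1[Z = 0] <= (Z / Phi - 1)^2 where Z counts the uncovered
   elements of [X] and Phi approximates its mean. *)
Lemma second_moment p (X : {set G}) (a : G -> R) (bad : G -> {set G}) (w D : R) :
  0 <= p <= 1 -> (forall x, x \in X -> x != 1%g) ->
  (forall x, 0 <= a x) -> 0 < \sum_(x in X) a x -> 0 <= w ->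
  (forall x, x \in X -> (1 - w) * a x <= expectation p (fun S => (uncovered x S)%:R)) ->
  (forall x, x \in X -> expectation p (fun S => (uncovered x S)%:R) <= 2 * a x) ->
  (forall x y, x \in X -> y \in X -> y \notin bad x ->
    expectation p (fun S => (uncovered x S)%:R * (uncovered y S)%:R) <=
    (1 + w) * (a x * a y)) ->
  (forall x, x \in X -> #|bad x|%:R <= D) ->
  expectation p (fun S => [forall (x | x != 1%g), ~~ uncovered x S]%:R) <=
  3 * w + 2 * D / \sum_(x in X) a x.
Proof.
move=> p01 X1 a0 Phi0 w0 lo up pair badD; set Phi := \sum_(x in X) a x.
pose u x S : R := (uncovered x S)%:R.
pose Z S : R := \sum_(x in X) u x S.
(* This integrand is [(Z S / Phi - 1) ^+ 2] expanded; it equals 1 where [Z S = 0]. *)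
apply: (@le_trans _ _ (expectation p (fun S =>
    Phi^-1 ^+ 2 * (Z S * Z S) - 2 * Phi^-1 * Z S + 1))).
  apply: ler_expectation => // S.
  have [/forall_inP cov|_] := boolP [forall (x | x != 1%g), ~~ uncovered x S].
    suff -> : Z S = 0 by rewrite !mulr0 subr0 add0r.
    by rewrite /Z big1 // => x /X1/cov /negPf ux; rewrite /u ux.
  have -> : Phi^-1 ^+ 2 * (Z S * Z S) - 2 * Phi^-1 * Z S + 1 =
     (Phi^-1 * Z S - 1) ^+ 2 by ring.
  exact: sqr_ge0.
rewrite expectationD expectationB !expectationZ expectation1.
have EZ : (1 - w) * Phi <= expectation p Z.
  by rewrite /Z expectation_sum mulr_sumr; apply: ler_sum.
have EZ2 : expectation p (fun S => Z S * Z S) <= (1 + w) * (Phi * Phi) + D * (2 * Phi).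
  have -> : expectation p (fun S => Z S * Z S) =
     \sum_(x in X) \sum_(y in X) expectation p (fun S => u x S * u y S).
    rewrite -(eq_bigr _ (fun x _ => expectation_sum p _ _ _)) -expectation_sum.
    apply: eq_bigr => S _; congr (_ * _); rewrite /Z mulr_suml.
    by apply: eq_bigr => x _; rewrite mulr_sumr.
  have -> : (1 + w) * (Phi * Phi) + D * (2 * Phi) =
     \sum_(x in X) ((1 + w) * (a x * Phi) + D * (2 * a x)).
    by rewrite big_split /= -!mulr_sumr -mulr_suml.
  apply: ler_sum => x xX.
  (* For [y] in [bad x] the indicator of [y] is simply bounded by 1. *)
  apply: (@le_trans _ _ (\sum_(y in X) ((1 + w) * (a x * a y) +
       (y \in bad x)%:R * (2 * a x)))).
    apply: ler_sum => y yX; have [yb|yb] := boolP (y \in bad x); last first.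
      by rewrite mul0r addr0 pair.
    rewrite mul1r; apply: (@le_trans _ _ (2 * a x)); last first.
      by rewrite lerDr !mulr_ge0 // addr_ge0.
    apply: le_trans (up x xX); apply: ler_expectation => // S; rewrite /u.
    by case: (uncovered y S); rewrite ?mulr1 ?mulr0.
  rewrite big_split /= -mulr_sumr -mulr_sumr lerD //.
  rewrite -mulr_suml ler_wpM2r ?mulr_ge0 //; apply: le_trans (badD x xX).
  rewrite -natr_sum ler_nat -sum1_card big_mkcond [X in (_ <= X)%N]big_mkcond.
  by apply: leq_sum => y _; do 2 case: (_ \in _).
have P0 : 0 < Phi^-1 by rewrite invr_gt0.
have PP : Phi^-1 * Phi = 1 by rewrite mulVf // gt_eqF.
have h1 : Phi^-1 * ((1 - w) * Phi) <= Phi^-1 * expectation p Z.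
  by rewrite ler_wpM2l // ltW.
have h2 := ler_wpM2l (ltW P0) (ler_wpM2l (ltW P0) EZ2).
have e1 : Phi^-1 * ((1 - w) * Phi) = 1 - w by rewrite mulrCA PP mulr1.
have e2 : Phi^-1 * (Phi^-1 * ((1 + w) * (Phi * Phi) + D * (2 * Phi))) =
    (1 + w) + 2 * D * Phi^-1.
  by field; rewrite gt_eqF.
rewrite e1 in h1; rewrite e2 in h2.
by rewrite expr2 -!mulrA in h1 h2 *; lra.
Qed.

End UncoveredProbability.

(** * Moment bounds at the scale of the square root of log n / n *)

Section Asymptotics.
Variables (R : realType) (G : finGroupType).
Implicit Types (x y g : G) (p c : R).
Local Notation edges x := (edge_set (dependency_graph x)).
Local Notation ne x := ((nonloop_edges (dependency_graph x))%:R : R).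
Local Notation nl x := ((loops (dependency_graph x))%:R : R).
Local Notation n := (#|G|%:R : R).
Local Notation t := (ln n).
Local Notation q := (Num.sqrt (ln n / n)).
Local Notation weight_sum p := (\sum_(x : G | x != 1%g) uncovered_weight p x).

Lemma order_gt0 : 0 < n.
Proof. by rewrite ltr0n; apply/card_gt0P; exists 1%g. Qed.

Lemma order_ge1 : 1 <= n.
Proof. by rewrite ler1n; apply/card_gt0P; exists 1%g. Qed.

Lemma expR_ln_order : expR t = n.
Proof. by rewrite lnK // posrE order_gt0. Qed.

Lemma ln_order_ge0 : 0 <= t.
Proof. by rewrite ln_ge0 // order_ge1. Qed.

Lemma scale_ge0 : 0 <= q. Proof. exact: sqrtr_ge0. Qed.

Lemma scale_sqr : q ^+ 2 * n = t.
Proof.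
rewrite sqr_sqrtr ?divfK ?gt_eqF ?order_gt0 //.
by rewrite divr_ge0 // ?ln_order_ge0 // ltW // order_gt0.
Qed.

(** The exponential series gives [n >= t ^+ 4 / 24], and [(q * t) ^+ 2 = t ^+ 3 / n]. *)
Lemma scale_ln_sqr : 1 <= t -> (q * t) ^+ 2 <= 24 / t.
Proof.
move=> t1; have t0 : 0 < t by lra.
have n0 := order_gt0; have nt : t ^+ 4 / 24 <= n.
  have := expR_ge1Dxn 3 (ltW t0); rewrite expR_ln_order /=.
  rewrite (_ : (4`!)%:R = 24) //; lra.
rewrite ler_pdivlMr // -(ler_pM2r n0).
have -> : (q * t) ^+ 2 * t * n = q ^+ 2 * n * t ^+ 3 by ring.
rewrite scale_sqr -exprS; lra.
Qed.

Lemma scale_ln_le (eta : R) : 0 < eta -> 1 <= t -> 24 / eta ^+ 2 <= t -> q * t <= eta.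
Proof.
move=> e0 t1 te; have t0 : 0 < t by lra.
have qt0 : 0 <= q * t by rewrite mulr_ge0 ?scale_ge0 // ltW.
rewrite -ler_sqr ?nnegrE ?(ltW e0) //; apply: le_trans (scale_ln_sqr t1) _.
by rewrite ler_pdivrMr // mulrC -ler_pdivrMr // exprn_gt0.
Qed.

Lemma scale_le_scale_ln : 1 <= t -> q <= q * t.
Proof. by move=> t1; rewrite -{1}[q]mulr1 ler_wpM2l ?scale_ge0. Qed.

Lemma scale_edges c x : 0 <= c -> (Num.sqrt c * q) ^+ 2 * ne x = c * t * (ne x / n).
Proof.
move=> c0; have n0 : n != 0 by rewrite gt_eqF ?order_gt0.
by rewrite exprMn sqr_sqrtr // -{2}scale_sqr; field.
Qed.

Lemma fGxE x c : 0 <= c -> fGx x c =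
  expR (- ((Num.sqrt c * q) ^+ 2 * ne x +
           (if (x ^+ 2 == 1)%g then 1 else 2) * (Num.sqrt c * q) * nl x)).
Proof.
move=> c0; rewrite /fGx /gG -powRrM {1}/powR gt_eqF ?order_gt0 //.
have -> : hG R x `^ Num.sqrt c =
    expR (- ((if (x ^+ 2 == 1)%g then 1 else 2) * (Num.sqrt c * q) * nl x)).
  by rewrite /hG; case: ifP => _; rewrite -expRM; congr expR; ring.
have -> : - (ne x / n) * c * t = - ((Num.sqrt c * q) ^+ 2 * ne x).
  by rewrite scale_edges //; ring.
by rewrite -expRD opprD.
Qed.

Lemma edges_order_ge x : x != 1%g -> 1 / 2 <= ne x / n.
Proof.
move=> x1; rewrite ler_pdivlMr ?order_gt0 //; have := @ne_ge R G x x1.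
lra.
Qed.

Lemma fG_le_weight_sum c : 0 <= c -> fG G c <= weight_sum (Num.sqrt c * q).
Proof.
move=> c0; apply: ler_sum => x _; rewrite fGxE // ler_expR lerN2 lerD2l.
rewrite -mulrA ler_peMl ?mulr_ge0 ?sqrtr_ge0 //.
by case: ifP => _ //; rewrite ler1n.
Qed.

(** Each term gains the factor [n ^ ((c - c') / 2)] because its graph has at least [n / 2] edges;
    the loop factor changes in the same direction. *)
Lemma fG_gap c' c : 0 <= c' -> c' <= c ->
  fG G c * expR ((c - c') / 2 * t) <= fG G c'.
Proof.
move=> c0 cc; have c0' : 0 <= c by apply: le_trans cc.
have t0 := ln_order_ge0.
rewrite mulr_suml; apply: ler_sum => x x1; rewrite !fGxE // -expRD ler_expR.
rewrite !scale_edges // -!mulrA.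
have h1 : (c - c') * (t * (1 / 2)) <= (c - c') * (t * (ne x / n)).
  by rewrite !ler_wpM2l ?subr_ge0 // edges_order_ge.
set k := if _ then _ else _.
have h2 : k * (Num.sqrt c' * (q * nl x)) <= k * (Num.sqrt c * (q * nl x)).
  rewrite ler_wpM2l //; first by rewrite /k; case: ifP.
  by rewrite ler_wpM2r ?mulr_ge0 ?scale_ge0 // ler_wsqrtr.
lra.
Qed.

Lemma weight_sum_gap c' c : 0 <= c' -> c' <= c ->
  weight_sum (Num.sqrt c * q) * expR ((c - c') / 2 * t) <=
  weight_sum (Num.sqrt c' * q).
Proof.
move=> c0 cc; have c0' : 0 <= c by apply: le_trans cc.
have t0 := ln_order_ge0.
rewrite mulr_suml; apply: ler_sum => x x1; rewrite /uncovered_weight -expRD ler_expR.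
rewrite !scale_edges // -!mulrA.
have h1 : (c - c') * (t * (1 / 2)) <= (c - c') * (t * (ne x / n)).
  by rewrite !ler_wpM2l ?subr_ge0 // edges_order_ge.
have h2 : (Num.sqrt c' * (q * nl x)) <= (Num.sqrt c * (q * nl x)).
  by rewrite ler_wpM2r ?mulr_ge0 ?scale_ge0 // ler_wsqrtr.
lra.
Qed.

(** Passing from [c] down to [c'] absorbs the factor [1 - 16 * p] of [uncovered_prob_le]. *)
Lemma first_moment_bound c' c : 0 <= c' -> 0 < c ->
  let p := Num.sqrt c * q in
  16 * p <= 1 -> Num.sqrt c' <= (1 - 16 * p) * Num.sqrt c ->
  cayley_prob p (fun e : rel G => (2%:E < diameter R e)%E) <=
  weight_sum (Num.sqrt c' * q).
Proof.
move=> c'0 c0 p p16 cc'.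
have p0 : 0 <= p by rewrite mulr_ge0 ?sqrtr_ge0.
have p01 : 0 <= p <= 1 by lra.
rewrite cayley_prob_gt2 cayley_prob_le2.
apply: le_trans (union_bound G p01) _; apply: ler_sum => x x1.
apply: le_trans (uncovered_prob_le x p0 p16) _; rewrite ler_expR lerN2.
set p' := _ * q; have p'0 : 0 <= p' by rewrite mulr_ge0 ?sqrtr_ge0.
have pp : p' <= (1 - 16 * p) * p.
  by rewrite [leRHS]mulrA; apply: ler_wpM2r cc'; exact: scale_ge0.
have pp2 : p' ^+ 2 <= (1 - 16 * p) * p ^+ 2.
  have : p' * p' <= (1 - 16 * p) * p * ((1 - 16 * p) * p) by rewrite ler_pM.
  move=> /le_trans h; rewrite expr2; apply: h.
  rewrite -subr_ge0 [X in 0 <= X](_ : _ = (1 - 16 * p) * (16 * p) * p ^+ 2); last by ring.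
  have a0 : 0 <= 1 - 16 * p by lra.
  have b0 : 0 <= 16 * p by lra.
  exact: (mulr_ge0 (mulr_ge0 a0 b0) (sqr_ge0 p)).
rewrite mulrDr; apply: lerD; rewrite [leRHS]mulrA.
  exact: ler_wpM2r (ler0n _ _) _ _ pp2.
exact: ler_wpM2r (ler0n _ _) _ _ pp.
Qed.


(** The error [w] collects [c / t] from the common edges of a good pair, [32 * p * t] from loops and
    [256 * c * p * t] from edges, doubled by [expR_le_1D2x]. *)
Lemma second_moment_bound p c (M w : R) : 0 < c -> 0 <= p -> p ^+ 2 * n = c * t ->
  2 <= t -> w = 2 * (c / t + (32 + 256 * c) * (p * t)) -> w <= 1 ->
  1 < M -> M <= weight_sum p ->
  cayley_prob p (fun e : rel G => (diameter R e <= 2%:E)%E) <=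
  3 * w + 64 * t ^+ 2 / (M - 1).
Proof.
move=> c0 p0 pn t2 wE w1 M1 MW; rewrite cayley_prob_le2.
have t0 : 0 < t by lra.
have n0 := order_gt0.
have ct0 : 0 < c / t by rewrite divr_gt0.
have pt0 : 0 <= p * t by rewrite mulr_ge0 // ltW.
have cpt0 : 0 <= c * (p * t) by rewrite mulr_ge0 // ltW.
have wE' : w = 2 * (c / t) + 64 * (p * t) + 512 * (c * (p * t)) by rewrite wE; ring.
have ppt : 2 * p <= p * t by rewrite mulrC ler_wpM2l.
have p32 : 32 * p <= 1 / 2 by lra.
have p01 : 0 <= p <= 1 by lra.
(* Elements with more loops weigh at most [1 / n] each, so at most 1 in total; this is the [1] in
   [M - 1]. *)
pose X := [set x : G | (x != 1%g) && (p * nl x <= t)]%SET.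
have X1 x : x \in X -> x != 1%g by rewrite inE => /andP[].
have Xl x : x \in X -> p * nl x <= t by rewrite inE => /andP[].
have pe x : p ^+ 2 * ne x <= 4 * (c * t).
  rewrite -pn mulrCA; apply: ler_wpM2l; first exact: sqr_ge0.
  exact: ne_le.
have WX : M - 1 <= \sum_(x in X) uncovered_weight p x.
  rewrite lerBlDr; apply: le_trans MW _.
  rewrite (bigID (fun x => p * nl x <= t)) /=; apply: lerD.
    rewrite [leRHS](eq_bigl (fun x => (x != 1%g) && (p * nl x <= t))) // => x.
    by rewrite inE.
  apply: (@le_trans _ _ (\sum_(x : G) n^-1)); last first.
    by rewrite sumr_const -[leLHS]mulr_natl divff // gt_eqF.
  rewrite [leRHS](bigID (fun x : G => (x != 1%g) && ~~ (p * nl x <= t))) /=.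
  rewrite -[leLHS]addr0; apply: lerD; last first.
    by apply: sumr_ge0 => x _; rewrite invr_ge0 ltW.
  apply: ler_sum => x /andP[_]; rewrite -ltNge => lt.
  rewrite -expR_ln_order -expRN ler_expR lerN2.
  have : 0 <= p ^+ 2 * ne x by rewrite mulr_ge0 ?sqr_ge0.
  lra.
(* Since [sum_common_edges] gives at most [8 * (4 * n)] in total, at most [32 * t ^+ 2] elements are
   bad for [x]. Both [x] and [x^-1] are bad, as they share all the edges, of which there are at
   least [n / 2]. *)
pose bad x := [set y : G | n / t ^+ 2 < #|edges x :&: edges y|%:R]%SET.
have nt2 : n / t ^+ 2 < n / 2.
  by rewrite ltr_pM2l // ltf_pV2 ?posrE ?exprn_gt0 //; nra.
have badx x y : x != 1%g -> y \notin bad x -> y != x /\ y != x^-1%g.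
  move=> x1; rewrite inE -leNgt => cm.
  have key : edges y = edges x -> False.
    move=> exy; move: cm; rewrite exy finset.setIid -[#|edges x|%:R]/(ne x).
    have := @ne_ge R G x x1; lra.
  by split; apply/eqP => yx; apply: key; rewrite yx ?edge_setV.
have Phi0 : 0 < \sum_(x in X) uncovered_weight p x by lra.
apply: (@le_trans _ _ (3 * w + 2 * (32 * t ^+ 2) / \sum_(x in X) uncovered_weight p x)); last first.
  rewrite lerD2l; have -> : 2 * (32 * t ^+ 2) = 64 * t ^+ 2 by ring.
  rewrite ler_wpM2l //; first by rewrite mulr_ge0 // sqr_ge0.
  by rewrite lef_pV2 // posrE; lra.
apply: (second_moment (bad := bad)) => //.
- by move=> x; apply: expR_ge0.
- by rewrite wE'; lra.
- move=> x xX; have ph : 0 <= p <= 1 / 2 by lra.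
  apply: le_trans (uncovered_prob_ge x ph); rewrite mulrC.
  apply: ler_wpM2l; first exact: expR_ge0.
  apply: le_trans (expR_ge1Dx _); rewrite lerD2l lerN2 wE'.
  have h1 : p * (p * nl x) <= p * t by rewrite ler_wpM2l // Xl.
  have q0 : 0 <= p ^+ 2 * ne x := mulr_ge0 (sqr_ge0 _) (ler0n _ _).
  have p1 : p <= 1 by lra.
  have h2 := ler_wpM2l p0 (ler_pM p0 q0 p1 (pe x)).
  have h3 : p * p <= p * 1 by rewrite ler_wpM2l //; lra.
  have -> : 2 * p ^+ 2 * nl x + 2 * p + 4 * p ^+ 2 + 2 * p ^+ 4 * ne x =
    2 * (p * (p * nl x)) + 2 * p + 4 * (p * p) + 2 * (p * (p * (p ^+ 2 * ne x))).
    by ring.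
  have e3 : p * (1 * (4 * (c * t))) = 4 * (c * (p * t)) by ring.
  lra.
- move=> x xX; apply: le_trans (uncovered_prob_le x p0 _) _; first lra.
  rewrite /uncovered_weight.
  have -> : - ((1 - 16 * p) * (p ^+ 2 * ne x + p * nl x)) =
     - (p ^+ 2 * ne x + p * nl x) + 16 * p * (p ^+ 2 * ne x + p * nl x) by ring.
  rewrite expRD mulrC; apply: ler_wpM2r; first exact: expR_ge0.
  apply: (@le_trans _ _ (expR (1 / 2))); last first.
    have := @expR_le_1D2x R (1 / 2); lra.
  rewrite ler_expR.
  have h : p * (p ^+ 2 * ne x + p * nl x) <= p * (4 * (c * t) + t).
    apply: ler_wpM2l => //; apply: lerD; [exact: pe|exact: Xl].
  have e3 : p * (4 * (c * t) + t) = 4 * (c * (p * t)) + p * t by ring.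
  rewrite -mulrA; lra.
- move=> x y xX yX yb; have [yx yx'] := badx x y (X1 x xX) yb.
  apply: le_trans (uncovered_pair_prob_le p0 _ (X1 x xX) (X1 y yX) yx yx') _; first lra.
  rewrite mulrC; apply: ler_wpM2r; first by rewrite mulr_ge0 ?expR_ge0.
  set u := (X in expR X).
  suff uw : 0 <= u <= w / 2.
    have uh : 0 <= u <= 1 / 2 by lra.
    by apply: le_trans (expR_le_1D2x uh) _; lra.
  have cm : p ^+ 2 * #|edges x :&: edges y|%:R <= c / t.
    move: yb; rewrite inE -leNgt => cm.
    have -> : c / t = p ^+ 2 * (n / t ^+ 2).
      by rewrite mulrA pn; field; rewrite gt_eqF.
    by apply: ler_wpM2l => //; apply: sqr_ge0.
  have hx : p * (p * nl x) <= p * t by rewrite ler_wpM2l // Xl.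
  have hy : p * (p * nl y) <= p * t by rewrite ler_wpM2l // Xl.
  have ex : p * (p ^+ 2 * ne x) <= p * (4 * (c * t)) by rewrite ler_wpM2l.
  have ey : p * (p ^+ 2 * ne y) <= p * (4 * (c * t)) by rewrite ler_wpM2l.
  have e3 : p * (4 * (c * t)) = 4 * (c * (p * t)) by ring.
  have uE : u = p ^+ 2 * #|edges x :&: edges y|%:R +
     16 * (p * (p * nl x)) + 16 * (p * (p * nl y)) +
     32 * (p * (p ^+ 2 * ne x)) + 32 * (p * (p ^+ 2 * ne y)) by rewrite /u; ring.
  rewrite wE' uE; apply/andP; split; last lra.
  have cm0 : 0 <= p ^+ 2 * #|edges x :&: edges y|%:R := mulr_ge0 (sqr_ge0 _) (ler0n _ _).
  have lx0 : 0 <= p * (p * nl x) := mulr_ge0 p0 (mulr_ge0 p0 (ler0n _ _)).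
  have ly0 : 0 <= p * (p * nl y) := mulr_ge0 p0 (mulr_ge0 p0 (ler0n _ _)).
  have ex0 : 0 <= p * (p ^+ 2 * ne x) := mulr_ge0 p0 (mulr_ge0 (sqr_ge0 _) (ler0n _ _)).
  have ey0 : 0 <= p * (p ^+ 2 * ne y) := mulr_ge0 p0 (mulr_ge0 (sqr_ge0 _) (ler0n _ _)).
  lra.
- move=> x xX.
  have nt0 : 0 < n / t ^+ 2 by rewrite divr_gt0 ?exprn_gt0.
  rewrite -(ler_pM2r nt0).
  have -> : 32 * t ^+ 2 * (n / t ^+ 2) = 32 * n by field; rewrite gt_eqF.
  apply: (@le_trans _ _ (\sum_y #|edges x :&: edges y|%:R)); last first.
    rewrite -natr_sum; apply: (@le_trans _ _ (8 * ne x)).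
      by rewrite -natrM ler_nat sum_common_edges.
    have := @ne_le R G x; lra.
  rewrite (bigID (mem (bad x))) /= -[leLHS]addr0; apply: lerD; last exact: sumr_ge0.
  have -> : #|bad x|%:R * (n / t ^+ 2) = \sum_(y in bad x) n / t ^+ 2.
    by rewrite sumr_const mulr_natl.
  by apply: ler_sum => y; rewrite inE => /ltW.
Qed.

End Asymptotics.

(** * Comparison of [fG] with the sum of the weights *)

Section LoopComparison.
Variables (R : realType) (G : finGroupType).
Implicit Types (x y g : G) (p c : R).
Local Notation ne x := ((nonloop_edges (dependency_graph x))%:R : R).
Local Notation nl x := ((loops (dependency_graph x))%:R : R).
Local Notation n := (#|G|%:R : R).
Local Notation t := (ln n).
Local Notation q := (Num.sqrt (ln n / n)).
Local Notation weight_sum p := (\sum_(x : G | x != 1%g) uncovered_weight p x).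

Definition many_loops (d : R) : {set G} :=
  [set x : G | (x != 1%g) && (d * t < q * nl x)]%SET.

(** Markov's inequality with [sum_loops] bounds the count by [2 / (d * q)], and [1 / q] is at most
    the square root of [n] when [t >= 1]. *)
Lemma card_many_loops (d : R) : 0 < d -> 1 <= t ->
  #|many_loops d|%:R <= 2 / d * expR (t / 2).
Proof.
move=> d0 t1; have t0 : 0 < t by lra.
have n0 := order_gt0 R G.
have q0 := scale_ge0 R G.
have qn := scale_sqr R G.
have h : #|many_loops d|%:R * (d * t) <= q * (2 * n).
  have -> : #|many_loops d|%:R * (d * t) = \sum_(x in many_loops d) d * t.
    by rewrite sumr_const mulr_natl.
  apply: (@le_trans _ _ (\sum_(x : G | x != 1%g) q * nl x)).
    rewrite [leRHS](bigID (mem (many_loops d))) /= -[leLHS]addr0; apply: lerD.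
      rewrite [leRHS](eq_bigl (mem (many_loops d))) => [|x]; last first.
        by rewrite /= !inE; case: (x != 1%g).
      by apply: ler_sum => x; rewrite inE => /andP[_ /ltW].
    by apply: sumr_ge0 => x _; apply: mulr_ge0.
  rewrite -mulr_sumr; apply: ler_wpM2l => //.
  by rewrite -natr_sum -natrM ler_nat; apply: sum_loops.
have qE : 1 <= q * expR (t / 2).
  have e0 := expR_gt0 (t / 2).
  rewrite -(@ler_sqr R) ?nnegrE ?mulr_ge0 // ?(ltW e0) // expr1n exprMn.
  have -> : expR (t / 2) ^+ 2 = n.
    by rewrite -expRM_natl mulrC divfK // expR_ln_order.
  by rewrite qn.
have {}h : #|many_loops d|%:R * d * q <= 2.
  have qp : 0 < q.
    rewrite lt_def q0 andbT; apply/eqP => qz; move: qE; rewrite qz mul0r; lra.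
  have qn0 : 0 < q * n by rewrite mulr_gt0.
  rewrite -(ler_pM2r qn0).
  have -> : #|many_loops d|%:R * d * q * (q * n) = #|many_loops d|%:R * (d * (q ^+ 2 * n)).
    by ring.
  by rewrite qn; apply: le_trans h _; rewrite mulrCA.
have m0 : 0 <= #|many_loops d|%:R * d by rewrite mulr_ge0 // ltW.
have := ler_wpM2l m0 qE; rewrite mulr1 => h2.
have := ler_wpM2r (ltW (expR_gt0 (t / 2))) h => h3.
rewrite mulrAC ler_pdivlMr //; apply: le_trans h2 _.
by rewrite mulrA.
Qed.

(** Without the few elements with many loops, [Y] keeps [s / 2 * n] members, each contributing at
    least [expR (- v)] to [fG]. As the sum is at most 1, [v] is at least [(1 - eta) * t]. *)
Lemma edges_ge_of_fG_le1 (c d s eta E : R) (Y : {set G}) : 0 < c -> 0 < d ->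
  0 < s -> 0 < eta -> 1 <= t -> 2 / (s * eta) <= t ->
  2 / d * expR (t / 2) + 1 <= s / 2 * n ->
  (forall x, x \in Y -> x != 1%g) -> s * n - 1 <= #|Y|%:R ->
  (forall x, x \in Y -> ne x <= E) -> fG G c <= 1 ->
  1 - 2 * Num.sqrt c * d - eta <= c * (E / n).
Proof.
move=> c0 d0 s0 eta0 t1 tbig nbig Y1 cY YE f1.
have t0 : 0 < t by lra.
have n0 := order_gt0 R G.
pose B := many_loops d; pose v := c * t * (E / n) + 2 * Num.sqrt c * (d * t).
have cYB : s / 2 * n <= #|Y :\: B|%:R.
  have := card_many_loops d0 t1; rewrite -/B => cB.
  have : #|Y|%:R <= #|B|%:R + #|Y :\: B|%:R :> R.
    rewrite -natrD ler_nat -(cardsID B Y) leq_add2r subset_leq_card //.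
    exact: finset.subsetIr.
  lra.
have le1 : s / 2 * n * expR (- v) <= 1.
  apply: le_trans f1.
  apply: (@le_trans _ _ (\sum_(x in Y :\: B) expR (- v))).
    by rewrite sumr_const -[leRHS]mulr_natl; apply: ler_wpM2r => //; apply: expR_ge0.
  rewrite /fG [leRHS](bigID (mem (Y :\: B))) /= -[leLHS]addr0; apply: lerD; last first.
    by apply: sumr_ge0 => x _; rewrite fGxE ?expR_ge0 // ltW.
  rewrite [leRHS](eq_bigl (mem (Y :\: B))) => [|x]; last first.
    by rewrite /= inE; case: (boolP (x \in Y)) => [/Y1 ->|] //=; rewrite ?andbF.
  apply: ler_sum => x; rewrite inE => /andP[xB xY].
  rewrite fGxE ?(ltW c0) // ler_expR lerN2 scale_edges ?(ltW c0) //; apply: lerD.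
    apply: ler_wpM2l; first by rewrite mulr_ge0 // ltW.
    by rewrite ler_pM2r ?invr_gt0 // YE.
  have xl : q * nl x <= d * t by move: xB; rewrite inE Y1 //= -leNgt.
  set k := if _ then _ else _.
  have k2 : 0 <= k <= 2 by rewrite /k; case: ifP => _; lra.
  rewrite -!mulrA [leRHS]mulrA.
  have sl : 0 <= Num.sqrt c * (q * nl x) by rewrite !mulr_ge0 ?sqrtr_ge0.
  have sl2 : Num.sqrt c * (q * nl x) <= Num.sqrt c * (d * t).
    by rewrite ler_wpM2l ?sqrtr_ge0.
  rewrite -[leRHS]mulrA; apply: ler_pM => //; lra.
have : expR (t - v) <= 2 / s.
  rewrite expRD expR_ln_order ler_pdivlMr //; lra.
move=> /(le_trans (expR_ge1Dx _)) h.
have h2 : 2 / s <= eta * t.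
  have -> : 2 / s = eta * (2 / (s * eta)) by field; rewrite !gt_eqF.
  by rewrite ler_wpM2l // ltW.
rewrite -(ler_pM2r t0); rewrite /v in h; lra.
Qed.


(* Only O(n^(1/2)) elements [x] have many loops. If [x^2 <> 1] and r is the number of
   square roots of [x^2], then the set of all [y] with [y^2 = x^2] (when r is
   proportional to n), or else the whole group, has size of order n and consists of
   elements whose dependency graphs have at most about twice as many edges as that
   of [x]. So these [x] contribute about the square root of what that set does. *)
Lemma weight_sum_le1_bound (c' c d s eta nu : R) : 0 < c' -> c' < c -> 0 < d ->
  0 < s <= 1 -> 0 < eta -> 0 < nu ->
  2 * Num.sqrt c' * d <= (c - c') / 4 ->
  1 / 2 + 2 * nu <= c * ((1 - 2 * Num.sqrt c' * d - eta) / (2 * c')) - c * s ->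
  1 <= t -> 4 / (c - c') <= t -> 2 / (s * eta) <= t ->
  2 / d * expR (t / 2) + 1 <= s / 2 * n -> 2 / d <= nu * t -> Num.sqrt c * q <= 2 ->
  fG G c' <= 1 -> weight_sum (Num.sqrt c * q) <= 1.
Proof.
move=> c'0 cc d0 /andP[s0 s1] eta0 nu0 dle nule t1 t4 tse nbig tnu p2 f1.
have t0 : 0 < t by lra.
have n0 := order_gt0 R G.
have q0 := scale_ge0 R G.
have c0 : 0 < c by lra.
set p := Num.sqrt c * q; have p0 : 0 <= p by rewrite mulr_ge0 ?sqrtr_ge0.
have tc : 1 <= (c - c') / 4 * t.
  by move: t4; rewrite ler_pdivrMr ?subr_gt0 // => h; lra.
pose X := [set x in many_loops d | (x ^+ 2 != 1)%g]%SET.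
have e1h : expR (- 1) <= 1 / 2 :> R.
  have := expR_ge1Dx (1 : R); rewrite expRN => h.
  by rewrite -[leRHS]invrK lef_pV2 ?posrE ?expR_gt0 //; lra.
rewrite (bigID (mem X)) /=.
have -> : (1 : R) = 1 / 2 + 1 / 2 by lra.
apply: lerD; last first.
  (* Outside [X], raising [c'] to [c] gains at least [(c - c') / 2 * t] on the edges, and the
     doubled loops of [fG] cost at most half of that. What is left is at least 1, and
     [expR (- 1) <= 1 / 2]. *)
  apply: (@le_trans _ _ (1 / 2 * fG G c')); last by lra.
  rewrite /fG mulr_sumr [leRHS](bigID (mem X)) /= -[leLHS]add0r; apply: lerD.
    by apply: sumr_ge0 => x _; rewrite fGxE ?(ltW c'0) // mulr_ge0 ?expR_ge0.
  apply: ler_sum => x /andP[x1 xX].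
  rewrite fGxE ?(ltW c'0) //.
  apply: (@le_trans _ _ (expR (- 1) * expR (- ((Num.sqrt c' * q) ^+ 2 * ne x +
       (if (x ^+ 2 == 1)%g then 1 else 2) * (Num.sqrt c' * q) * nl x)))); last first.
    by apply: ler_wpM2r => //; apply: expR_ge0.
  rewrite /uncovered_weight -expRD ler_expR /p !scale_edges ?(ltW c0) ?(ltW c'0) //.
  have h1 : (c - c') * t * (1 / 2) <= (c - c') * t * (ne x / n).
    apply: ler_wpM2l; last exact: edges_order_ge.
    by rewrite mulr_ge0 ?subr_ge0 // ltW.
  have ql0 : 0 <= q * nl x by rewrite mulr_ge0.
  have h2 : Num.sqrt c' * (q * nl x) <= Num.sqrt c * (q * nl x).
    by apply: ler_wpM2r => //; apply: ler_wsqrtr; apply: ltW.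
  have h0 : 0 <= Num.sqrt c' * (q * nl x) by rewrite mulr_ge0 ?sqrtr_ge0.
  move: xX; rewrite !inE x1 /= negb_and negbK => /orP[|x2].
    rewrite -leNgt => xl.
    have h3 : 2 * Num.sqrt c' * (q * nl x) <= 2 * Num.sqrt c' * (d * t).
      by apply: ler_wpM2l => //; rewrite mulr_ge0 ?sqrtr_ge0.
    have h4 : 2 * Num.sqrt c' * d * t <= (c - c') / 4 * t.
      by apply: ler_wpM2r => //; apply: ltW.
    by case: ifP => _; lra.
  by rewrite x2; lra.
(* An exponent above [1 / 2] beats the bound of order [n ^ (1 / 2)] on the size of [X]. *)
pose K := 1 / 2 + 2 * nu.
have term x : x \in X -> uncovered_weight p x <= expR (- (K * t)).
  rewrite !inE => /andP[/andP[x1 xl] x2]; rewrite /uncovered_weight ler_expR lerN2.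
  pose i := (square_roots (1%g : G))%:R : R.
  pose r := (square_roots (x ^+ 2)%g)%:R : R.
  have i0 : 0 <= i := ler0n _ _.
  have r0 : 0 <= r := ler0n _ _.
  have lo : 4 * n <= 2 * ne x + nl x + 2 * i + 2 * r.
    by rewrite /i /r -!natrM -!natrD ler_nat nonloop_edges_ge_sqrt.
  have cost : c * t * (2 - i / n - r / n) <= p ^+ 2 * ne x + p * nl x.
    have pl : p ^+ 2 * nl x <= 2 * (p * nl x).
      rewrite expr2 -mulrA; apply: ler_wpM2r => //.
      by rewrite mulr_ge0.
    have pn : p ^+ 2 * n = c * t.
      by rewrite exprMn sqr_sqrtr ?(ltW c0) // -mulrA scale_sqr.
    have -> : c * t * (2 - i / n - r / n) = p ^+ 2 * (2 * n - i - r).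
      by rewrite -pn; field; rewrite gt_eqF.
    have := ler_wpM2l (sqr_ge0 p) lo; lra.
  apply: le_trans cost.
  have ct0 : 0 < c * t by rewrite mulr_gt0.
  set b := 1 - 2 * Num.sqrt c' * d - eta in nule.
  suff key : b / (2 * c') - s <= 2 - i / n - r / n.
    have := ler_wpM2l (ltW c0) key; rewrite mulrBr => k2.
    have k3 : K <= c * (2 - i / n - r / n) by rewrite /K; lra.
    by have := ler_wpM2r (ltW t0) k3; rewrite mulrAC.
  rewrite lerBlDr ler_pdivrMr ?mulr_gt0 //.
  (* If [x ^+ 2] has many square roots, they all satisfy the edge bound of [nonloop_edges_le_sqrt].
     If it has few, the bound valid for all non-identity elements is as good up to [r / n <= s]; the
     [- 1] in the size of [Y] then accounts for the identity. *)
  have [rs|rs] := leP (s * n) r.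
    pose Y := [set y : G | (y ^+ 2)%g == (x ^+ 2)%g]%SET.
    have YE y : y \in Y -> ne y <= 4 * n - 2 * i - 2 * r.
      rewrite inE => /eqP y2.
      have := @nonloop_edges_le_sqrt G y; rewrite y2 => /(_ x2).
      move=> le4; suff : ne y + 2 * i + 2 * r <= 4 * n by lra.
      by rewrite /i /r -!natrM -!natrD ler_nat.
    have Y1 y : y \in Y -> y != 1%g.
      by rewrite inE => /eqP y2; apply: contra x2 => /eqP y1; rewrite -y2 y1 expg1n.
    have cY : s * n - 1 <= #|Y|%:R by rewrite -[#|Y|%:R]/r; lra.
    have := edges_ge_of_fG_le1 c'0 d0 s0 eta0 t1 tse nbig Y1 cY YE f1.
    have -> : (4 * n - 2 * i - 2 * r) / n = 2 * (2 - i / n - r / n).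
      by field; rewrite gt_eqF.
    rewrite -/b => h; have : 0 <= s * (2 * c') by rewrite !mulr_ge0 // ltW.
    lra.
  pose Y := [set y : G | y != 1%g]%SET.
  have YE y : y \in Y -> ne y <= 4 * n - 2 * i.
    by move=> _; rewrite lerBrDr /i -!natrM -!natrD ler_nat nonloop_edges_le.
  have Y1 y : y \in Y -> y != 1%g by rewrite inE.
  have cY : s * n - 1 <= #|Y|%:R.
    have -> : #|Y|%:R = n - 1.
      have := cardsC [set 1%g : G]%SET; rewrite cards1 => cG.
      rewrite (_ : Y = ~: [set 1%g : G])%SET; last by apply/setP => y; rewrite !inE.
      by rewrite -cG natrD addrAC subrr add0r.
    have := ler_wpM2r (ltW n0) s1; lra.
  have := edges_ge_of_fG_le1 c'0 d0 s0 eta0 t1 tse nbig Y1 cY YE f1.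
  have -> : (4 * n - 2 * i) / n = 2 * (2 - i / n) by field; rewrite gt_eqF.
  rewrite -/b => h.
  have rs' : r / n <= s by rewrite ler_pdivrMr // ltW.
  have : 0 <= (s - r / n) * (2 * c') by rewrite !mulr_ge0 ?subr_ge0 // ltW.
  lra.
apply: (@le_trans _ _ (\sum_(x in X) expR (- (K * t)))).
  rewrite [leLHS](eq_bigl (mem X)) => [|x]; first exact: ler_sum.
  by rewrite /= !inE; case: (x != 1%g).
rewrite sumr_const -[leLHS]mulr_natl.
apply: (@le_trans _ _ (2 / d * expR (t / 2) * expR (- (K * t)))).
  apply: ler_wpM2r; first exact: expR_ge0.
  apply: le_trans (card_many_loops d0 t1); rewrite ler_nat subset_leq_card //.
  by apply/fintype.subsetP => x; rewrite inE => /andP[].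
rewrite -mulrA -expRD (_ : t / 2 + - (K * t) = - (2 * nu * t)); last by rewrite /K; field.
rewrite expRN -/(_ / _) ler_pdivrMr ?expR_gt0 //.
have := expR_ge1Dx (2 * nu * t); lra.
Qed.

End LoopComparison.

(** * Choice of constants, uniformly over large groups *)

Section Thresholds.
Variable R : realType.
Implicit Types (c tol : R) (G : finGroupType).
Local Notation lnG G := (ln (#|G|%:R : R)).
Local Notation scale G := (Num.sqrt (ln (#|G|%:R : R) / #|G|%:R)).
Local Notation prob_le2 G p :=
  (cayley_prob p (fun e : rel G => (diameter R e <= 2%:E)%E)).
Local Notation prob_gt2 G p :=
  (cayley_prob p (fun e : rel G => (2%:E < diameter R e)%E)).

Lemma scale_small (eta : R) : 0 < eta -> exists T, forall G, T <= lnG G ->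
  [/\ 1 <= lnG G, scale G * lnG G <= eta & scale G <= eta].
Proof.
move=> e0; exists (1 + 24 / eta ^+ 2) => G tT.
have h : 0 < 24 / eta ^+ 2 by rewrite divr_gt0 ?exprn_gt0.
have t1 : 1 <= lnG G by lra.
have qt : scale G * lnG G <= eta by apply: scale_ln_le => //; lra.
by split=> //; apply: le_trans qt; apply: scale_le_scale_ln.
Qed.

Lemma weight_sum_le1 c' c : 0 < c' -> c' < c -> exists T, forall G, T <= lnG G ->
  fG G c' <= 1 ->
  \sum_(x : G | x != 1%g) uncovered_weight (Num.sqrt c * scale G) x <= 1.
Proof.
move=> c'0 cc; have c0 : 0 < c by lra.
have D0 : 0 < c - c' by lra.
have s'0 : 0 < Num.sqrt c' by rewrite sqrtr_gt0.
have sc0 : 0 < Num.sqrt c by rewrite sqrtr_gt0.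
(* The losses [b] and [eta] cost at most [(c - c') / 4] out of [c], which leaves the exponent
   [1 / 2 + 3 * nu]; [s] is such that [c * s <= nu], so [1 / 2 + 2 * nu] survives. *)
pose b := (c - c') / (8 * c + 4); pose d := b / (2 * Num.sqrt c').
pose eta := (c - c') / (8 * c); pose nu := (c - c') / (8 * c').
pose s := nu / (c + nu).
have b0 : 0 < b by rewrite divr_gt0 //; lra.
have d0 : 0 < d by apply: divr_gt0 => //; apply: mulr_gt0.
have eta0 : 0 < eta by apply: divr_gt0 => //; apply: mulr_gt0.
have nu0 : 0 < nu by apply: divr_gt0 => //; apply: mulr_gt0.
have s0 : 0 < s by apply: divr_gt0 => //; apply: addr_gt0.
have s1 : s <= 1 by rewrite ler_pdivrMr ?addr_gt0 //; lra.
have bE : 2 * Num.sqrt c' * d = b by rewrite /d; field; rewrite gt_eqF.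
have b4 : b <= (c - c') / 4.
  by rewrite ler_wpM2l ?(ltW D0) // lef_pV2 ?posrE //; lra.
have be : b <= eta.
  by rewrite ler_wpM2l ?(ltW D0) // lef_pV2 ?posrE //; lra.
have ce : c * eta = (c - c') / 8 by rewrite /eta; field; rewrite gt_eqF.
have cs : c * s <= nu.
  by rewrite mulrA ler_pdivrMr ?addr_gt0 //; nra.
have main : 1 / 2 + 2 * nu <= c * ((1 - 2 * Num.sqrt c' * d - eta) / (2 * c')) - c * s.
  rewrite bE.
  have : (c - (c - c') / 4) / (2 * c') <= c * ((1 - b - eta) / (2 * c')).
    rewrite mulrA ler_pM2r ?invr_gt0 ?mulr_gt0 //.
    have := ler_wpM2l (ltW c0) be; lra.
  have -> : (c - (c - c') / 4) / (2 * c') = 1 / 2 + 3 * nu.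
    by rewrite /nu; field; rewrite gt_eqF.
  lra.
have [T0 small] := @scale_small (2 / Num.sqrt c) (divr_gt0 (ltr0Sn _ _) sc0).
pose T1 := 4 / (c - c'); pose T2 := 2 / (s * eta).
pose T3 := 2 * (2 / s * (2 / d + 1)); pose T4 := 2 / d / nu.
have T10 : 0 < T1 by apply: divr_gt0.
have T20 : 0 < T2 by apply: divr_gt0 => //; apply: mulr_gt0.
have d20 : 0 < 2 / d by rewrite divr_gt0.
have s20 : 0 < 2 / s by rewrite divr_gt0.
have T30 : 0 < T3.
  by apply: mulr_gt0 => //; apply: mulr_gt0 => //; apply: addr_gt0.
have T40 : 0 < T4 by apply: divr_gt0.
exists (`|T0| + T1 + T2 + T3 + T4) => G tT f1.
have T0n := ler_norm T0.
have T0p := normr_ge0 T0.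
have [t1 _ qs] : [/\ 1 <= lnG G, scale G * lnG G <= 2 / Num.sqrt c & scale G <= 2 / Num.sqrt c].
  by apply: small; lra.
apply: (weight_sum_le1_bound (c' := c') (d := d) (s := s) (eta := eta) (nu := nu)) => //.
- by rewrite s0 s1.
- by rewrite bE.
- by rewrite -/T1; lra.
- by rewrite -/T2; lra.
- have := expR_ge1Dx (lnG G / 2); set E := expR _ => Eg.
  (* With [E] the square root of the order, the right side is quadratic in [E] and the left side
     linear. *)
  have -> : (#|G|%:R : R) = E * E.
    by rewrite -expRD -splitr expR_ln_order.
  have E1 : 1 <= E by lra.
  have ET : T3 / 2 <= E by lra.
  have e3 : s / 2 * (T3 / 2) = 2 / d + 1 by rewrite /T3; field; rewrite !gt_eqF.
  have : s / 2 * (T3 / 2) <= s / 2 * E by rewrite ler_wpM2l // divr_ge0 // ltW.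
  rewrite e3 => h.
  have := ler_wpM2r (le_trans ler01 E1) h; rewrite mulrDl mul1r -[leRHS]mulrA => h'.
  by apply: le_trans h'; rewrite lerD2l.
- have : T4 <= lnG G by lra.
  by rewrite ler_pdivrMr // [leRHS]mulrC.
- by move: qs; rewrite ler_pdivlMr // mulrC.
Qed.

Lemma prob_gt2_small c' c tol : 0 < c' -> c' < c -> 0 < tol ->
  exists T, forall G, T <= lnG G -> fG G c' <= 1 ->
  prob_gt2 G (Num.sqrt c * scale G) <= tol.
Proof.
move=> c'0 cc tol0; have c0 : 0 < c by lra.
(* Three gaps with three uses: [c'] to [c1] passes from [fG] to the weights, [c1] to [c2] makes the
   sum of weights decay like a power of the order, and [c2] to [c] absorbs the factor
   [1 - 16 * p]. *)
pose c1 := (2 * c' + c) / 3; pose c2 := (c' + 2 * c) / 3.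
have c1' : c' < c1 by rewrite /c1; lra.
have c12 : c1 < c2 by rewrite /c1 /c2; lra.
have c2c : c2 < c by rewrite /c2; lra.
have c10 : 0 < c1 by lra.
have c20 : 0 < c2 by lra.
have sc : 0 < Num.sqrt c - Num.sqrt c2 by rewrite subr_gt0 ltr_sqrt.
have sc20 : 0 < Num.sqrt c2 by rewrite sqrtr_gt0.
have [T1 le1] := weight_sum_le1 c'0 c1'.
have [T2 small] := @scale_small ((Num.sqrt c - Num.sqrt c2) / (16 * c))
  (divr_gt0 sc (mulr_gt0 (ltr0Sn _ _) c0)).
pose th := (c2 - c1) / 2; have th0 : 0 < th by apply: divr_gt0 => //; rewrite subr_gt0.
pose T3 := 1 / tol / th; have T30 : 0 < T3 by apply: divr_gt0 => //; apply: divr_gt0.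
exists (`|T1| + `|T2| + T3) => G tT f1.
have := ler_norm T1; have := ler_norm T2; have := normr_ge0 T1; have := normr_ge0 T2.
move=> n2 n1 l2 l1.
have {}le1 := le1 G ltac:(lra) f1.
have [t1 _ qs] := small G ltac:(lra).
have gap := @weight_sum_gap R G c1 c2 (ltW c10) (ltW c12).
have cp : Num.sqrt c2 <= (1 - 16 * (Num.sqrt c * scale G)) * Num.sqrt c.
  move: qs; rewrite ler_pdivlMr ?mulr_gt0 // => qs.
  have := sqr_sqrtr (ltW c0); rewrite expr2 => cE; rewrite -{1}cE in qs.
  lra.
have p16 : 16 * (Num.sqrt c * scale G) <= 1.
  have sc0 : 0 < Num.sqrt c by rewrite sqrtr_gt0.
  have : 0 < (1 - 16 * (Num.sqrt c * scale G)) * Num.sqrt c by apply: lt_le_trans cp.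
  by rewrite pmulr_lgt0 // subr_gt0 => /ltW.
apply: le_trans (first_moment_bound (ltW c20) c0 p16 cp) _.
have {}gap := le_trans gap le1.
rewrite -(ler_pdivlMr _ _ (expR_gt0 _)) in gap; apply: le_trans gap _.
rewrite ler_pdivrMr ?expR_gt0 // -/th -ler_pdivrMl // mulrC.
apply: le_trans (expR_ge1Dx _).
have : T3 <= lnG G by lra.
rewrite /T3 ler_pdivrMr // => h; lra.
Qed.

Lemma prob_le2_small c' c tol : 0 < c' -> c' < c -> 0 < tol ->
  exists T, forall G, T <= lnG G -> 1 < fG G c ->
  prob_le2 G (Num.sqrt c' * scale G) <= tol.
Proof.
move=> c'0 cc tol0; have c0 : 0 < c by lra.
have s'0 : 0 < Num.sqrt c' by rewrite sqrtr_gt0.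
(* This gives [3 * w <= tol / 2]; the other half of [tol] is for the term with [M - 1]. *)
pose m := Num.min 1 (tol / 6).
have m0 : 0 < m by rewrite lt_min ltr01 divr_gt0.
have m1 : m <= 1 by rewrite ge_min lexx.
have m2 : m <= tol / 6 by rewrite ge_min lexx orbT.
pose k := (32 + 256 * c') * Num.sqrt c'.
have k0 : 0 < k.
  have k1 : 0 < 32 + 256 * c' by lra.
  exact: mulr_gt0.
have [T1 small] := @scale_small (m / 4 / k) (divr_gt0 (divr_gt0 m0 (ltr0Sn _ _)) k0).
pose th := (c - c') / 2; have th0 : 0 < th by apply: divr_gt0 => //; rewrite subr_gt0.
pose T2 := c' / (m / 4); have T20 : 0 < T2 by apply: divr_gt0 => //; apply: divr_gt0.
(* Here [768 = 64 * 12]: beyond [T3] the cubic term of the exponential, times [tol / 2], exceeds 64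
   times the squared logarithm. *)
pose T3 := 768 / tol / th ^+ 3; have T30 : 0 < T3.
  have n768 : 0 < 768 :> R by rewrite ltr0n.
  exact: (divr_gt0 (divr_gt0 n768 tol0) (exprn_gt0 _ th0)).
exists (`|T1| + T2 + T3 + 2) => G tT f1.
have := ler_norm T1; have := normr_ge0 T1 => n1 l1.
have [t1 qs _] := small G ltac:(lra).
have t0 : 0 < lnG G by lra.
pose w := 2 * (c' / lnG G + (32 + 256 * c') * (Num.sqrt c' * scale G * lnG G)).
have wm : w <= m.
  have h1 : c' / lnG G <= m / 4.
    have : T2 <= lnG G by lra.
    by rewrite /T2 ler_pdivrMr ?divr_gt0 // mulrC ler_pdivrMr.
  move: qs; rewrite ler_pdivlMr // => qs.
  have -> : w = 2 * (c' / lnG G) + 2 * (scale G * lnG G * k) by rewrite /w /k; ring.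
  lra.
have M1 : 1 < expR (th * lnG G) by rewrite expR_gt1 mulr_gt0.
have MW : expR (th * lnG G) <=
    \sum_(x : G | x != 1%g) uncovered_weight (Num.sqrt c' * scale G) x.
  apply: le_trans (weight_sum_gap G (ltW c'0) (ltW cc)).
  rewrite -/th ler_peMl ?expR_ge0 //.
  by apply: le_trans (fG_le_weight_sum G (ltW c0)); apply: ltW.
have pn : (Num.sqrt c' * scale G) ^+ 2 * #|G|%:R = c' * lnG G.
  by rewrite exprMn sqr_sqrtr ?(ltW c'0) // -mulrA scale_sqr.
have p0 : 0 <= Num.sqrt c' * scale G by rewrite mulr_ge0 ?sqrtr_ge0.
have t2 : 2 <= lnG G by lra.
have w1 : w <= 1 by lra.
apply: le_trans (second_moment_bound c'0 p0 pn t2 (erefl w) w1 M1 MW) _.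
suff : 64 * lnG G ^+ 2 / (expR (th * lnG G) - 1) <= tol / 2 by lra.
rewrite ler_pdivrMr ?subr_gt0 //.
have := expR_ge1Dxn 2 (ltW (mulr_gt0 th0 t0)); rewrite (_ : (3`!)%:R = 6) // => h.
have {}h : tol / 2 * ((th * lnG G) ^+ 3 / 6) <= tol / 2 * (expR (th * lnG G) - 1).
  by rewrite ler_wpM2l ?divr_ge0 ?(ltW tol0) //; lra.
apply: le_trans h.
have : T3 <= lnG G by lra.
rewrite /T3 ler_pdivrMr ?exprn_gt0 // ler_pdivrMr // => h.
have := ler_wpM2l (sqr_ge0 (lnG G)) h.
have -> : tol / 2 * ((th * lnG G) ^+ 3 / 6) =
   lnG G ^+ 2 * (lnG G * th ^+ 3 * tol) / 12 by field.
lra.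
Qed.


Lemma fG_ge0 G c : 0 <= fG G c.
Proof. by apply: sumr_ge0 => x _; rewrite mulr_ge0 ?powR_ge0. Qed.

Lemma prob_le2_ge0 G (p : R) : 0 <= p <= 1 -> 0 <= prob_le2 G p.
Proof. by move=> p01; rewrite cayley_prob_expectation expectation_ge0. Qed.

Lemma prob_gt2_ge0 G (p : R) : 0 <= p <= 1 -> 0 <= prob_gt2 G p.
Proof. by move=> p01; rewrite cayley_prob_expectation expectation_ge0. Qed.

Lemma prob_gt2_antitone G (p p' : R) : 0 <= p -> p <= p' -> p' <= 1 ->
  prob_gt2 G p' <= prob_gt2 G p.
Proof.
move=> p0 pp' p'1; rewrite !cayley_prob_expectation.
apply: expectation_antitone => // S S' SS'; rewrite ler_nat.
rewrite !ltNge !diameter_cayley_graph.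
have [//|/forallPn[x]] := boolP [forall (x | x != 1%g), ~~ uncovered x S'].
rewrite negb_imply negbK => /andP[x1 ux].
suff -> : [forall (x | x != 1%g), ~~ uncovered x S] = false by [].
apply/negbTE/forallPn; exists x; rewrite negb_imply x1 negbK.
have := uncovered_antitone R x SS'; rewrite ler_nat ux.
by case: (uncovered x S).
Qed.

Lemma prob_le2_gt2 G (p : R) : prob_le2 G p = 1 - prob_gt2 G p.
Proof. by rewrite cayley_prob_gt2 opprB addrC subrK. Qed.

Lemma prob_le2_isotone G (p p' : R) : 0 <= p -> p <= p' -> p' <= 1 ->
  prob_le2 G p <= prob_le2 G p'.
Proof.
by move=> p0 pp' p'1; rewrite !prob_le2_gt2 lerD2l lerN2 prob_gt2_antitone.
Qed.

End Thresholds.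

(** * Equivalence of the threshold property and the criterion on [fG] *)

Theorem theorem2p1 (R : realType) (c : R) (hc : 0 < c)
    (G : nat -> finGroupType) (hn : #|G k| @[k --> \oo] --> \oo) :
  diameter2_threshold G c <->
  (forall eps : R, 0 < eps ->
     (eps < c -> fG (G k) (c - eps) @[k --> \oo] --> +oo) /\
     fG (G k) (c + eps) @[k --> \oo] --> (0 : R)).
Proof.
have big T : \forall k \near \oo, T <= ln (#|G k|%:R : R).
  move/cvgnyPge: hn => /(_ (Num.truncn (expR T)).+1).
  apply: filterS => k kT; rewrite -[T]expRK ler_ln ?posrE ?expR_gt0 ?order_gt0 //.
  by apply: ltW; apply: lt_le_trans (truncnS_gt _) _; rewrite ler_nat.
pose crit (a : R) k : R := Num.sqrt (a * (ln #|G k|%:R / #|G k|%:R)).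
have critE a k : 0 <= a -> crit a k = Num.sqrt a * Num.sqrt (ln #|G k|%:R / #|G k|%:R).
  by move=> a0; rewrite /crit sqrtrM.
have crit0 a k : 0 <= crit a k by exact: sqrtr_ge0.
have crit1 a : 0 < a -> \forall k \near \oo, crit a k <= 1.
  move=> a0; have sa0 : 0 < Num.sqrt a by rewrite sqrtr_gt0.
  have [T small] := @scale_small R (1 / Num.sqrt a) (divr_gt0 ltr01 sa0).
  apply: filterS (big T) => k /small[_ _]; rewrite ler_pdivlMr // mulrC.
  by rewrite critE // ltW.
have gt2 a' a tol : 0 < a' -> a' < a -> 0 < tol -> \forall k \near \oo,
    fG (G k) a' <= 1 ->
    cayley_prob (crit a k) (fun e : rel (G k) => (2%:E < diameter R e)%E) <= tol.
  move=> a'0 aa tol0; have [T small] := prob_gt2_small a'0 aa tol0.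
  apply: filterS (big T) => k /small + f1 => /(_ f1).
  by rewrite critE //; lra.
have le2 a' a tol : 0 < a' -> a' < a -> 0 < tol -> \forall k \near \oo,
    1 < fG (G k) a ->
    cayley_prob (crit a' k) (fun e : rel (G k) => (diameter R e <= 2%:E)%E) <= tol.
  move=> a'0 aa tol0; have [T small] := prob_le2_small a'0 aa tol0.
  apply: filterS (big T) => k /small + f1 => /(_ f1).
  by rewrite critE //; lra.
split=> [thr eps eps0|cond ? eps eps0].
  have eps4 : 0 < eps / 4 by lra.
  (* The threshold property speaks of probabilities at every index, while [crit] may exceed 1 for
     small orders; the truncation agrees with it eventually. *)
  pose P a k := Num.min 1 (crit a k).
  have P01 a k : 0 <= P a k <= 1.
    by rewrite /P le_min ler01 crit0 ge_min lexx.
  have Pcrit a : 0 < a -> \forall k \near \oo, P a k = crit a k.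
    by move=> /crit1; apply: filterS => k c1; rewrite /P min_r.
  have [thr1 thr2] := thr _ eps4.
  have gap a a' k : 0 < a' -> a = a' + eps / 2 ->
      fG (G k) a * expR (eps / 4 * ln (#|G k|%:R : R)) <= fG (G k) a'.
    move=> a'0 aE; have -> : eps / 4 = (a - a') / 2 by lra.
    by apply: fG_gap; lra.
  split=> [epsc|].
    have c4 : eps / 4 < c by lra.
    have Ple : \forall k \near \oo, P (c - eps / 4) k <= crit (c - eps / 4) k.
      by apply: nearW => k; rewrite /P ge_min lexx orbT.
    have half : 0 < 1 / 2 :> R by lra.
    have /cvgrPdist_le/(_ _ half) close := thr1 c4 _ (P01 _) Ple.
    apply/cvgryPge => A; near=> k.
    (* A sum at most 1 here would make diameter above 2 unlikely at [c - eps / 4], against the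
       threshold property. Going down to [c - eps] then turns a value above 1 into growth like
       [n ^ (eps / 4)]. *)
    have f1 : 1 < fG (G k) (c - eps / 2).
      rewrite ltNge; apply/negP => f1.
      have : cayley_prob (crit (c - eps / 4) k)
          (fun e : rel (G k) => (2%:E < diameter R e)%E) <= 1 / 3.
        by move: f1; near: k; apply: gt2; lra.
      have hP : P (c - eps / 4) k = crit (c - eps / 4) k by near: k; apply: Pcrit; lra.
      have : `|1 - cayley_prob (P (c - eps / 4) k)
          (fun e : rel (G k) => (2%:E < diameter R e)%E)| <= 1 / 2 by near: k.
      rewrite hP ler_norml => /andP[_]; lra.
    have e0 : 0 <= expR (eps / 4 * ln (#|G k|%:R : R)) := expR_ge0 _.
    apply: (@le_trans _ _ (fG (G k) (c - eps / 2) * expR (eps / 4 * ln (#|G k|%:R : R)))).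
      apply: (@le_trans _ _ (expR (eps / 4 * ln (#|G k|%:R : R)))); last first.
        by rewrite ler_peMl // ltW.
      apply: le_trans (expR_ge1Dx _).
      have : A / (eps / 4) <= ln (#|G k|%:R : R) by near: k; apply: big.
      by rewrite ler_pdivrMr //; lra.
    by apply: gap; lra.
  have a40 : 0 < c + eps / 4 by lra.
  have Ple : \forall k \near \oo, crit (c + eps / 4) k <= P (c + eps / 4) k.
    by apply: filterS (Pcrit _ a40) => k ->.
  have half : 0 < 1 / 2 :> R by lra.
  have /cvgrPdist_le/(_ _ half) close := thr2 _ (P01 _) Ple.
  apply/cvgrPdist_le => tol tol0; near=> k.
  (* Dually, a sum above 1 would make diameter at most 2 unlikely at [c + eps / 4], and going up to
     [c + eps] gives decay like [n ^ (- eps / 4)]. *)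
  have f1 : fG (G k) (c + eps / 2) <= 1.
    rewrite leNgt; apply/negP => f1.
    have : cayley_prob (crit (c + eps / 4) k)
        (fun e : rel (G k) => (diameter R e <= 2%:E)%E) <= 1 / 3.
      by move: f1; near: k; apply: le2; lra.
    have hP : P (c + eps / 4) k = crit (c + eps / 4) k by near: k; apply: Pcrit.
    have : `|1 - cayley_prob (P (c + eps / 4) k)
        (fun e : rel (G k) => (diameter R e <= 2%:E)%E)| <= 1 / 2 by near: k.
    rewrite hP ler_norml => /andP[_]; lra.
  rewrite sub0r normrN ger0_norm ?fG_ge0 //.
  have e0 : 0 < expR (eps / 4 * ln (#|G k|%:R : R)) := expR_gt0 _.
  rewrite -(ler_pM2r e0).
  apply: (@le_trans _ _ (fG (G k) (c + eps / 2))); first by apply: gap; lra.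
  apply: le_trans f1 _.
  have : 1 / tol / (eps / 4) <= ln (#|G k|%:R : R) by near: k; apply: big.
  rewrite ler_pdivrMr // ler_pdivrMr // => h.
  have := ler_wpM2l (ltW tol0) (expR_ge1Dx (eps / 4 * ln (#|G k|%:R : R))).
  lra.
split=> [epsc p p01 pc|p p01 pc].
  apply/cvgrPdist_le => tol tol0.
  have [c2 _] := cond (eps / 2) ltac:(lra).
  have {c2} := c2 ltac:(lra); move=> /cvgryPge /(_ 2) f2.
  have ce0 : 0 < c - eps by lra.
  near=> k.
  rewrite cayley_prob_gt2 opprB addrC subrK ger0_norm; last by apply: prob_le2_ge0.
  (* By monotonicity in [p] only the critical probability matters, and [eps / 2] separates it from
     the constant at which [fG] is controlled. *)
  apply: (@le_trans _ _ (cayley_prob (crit (c - eps) k)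
      (fun e : rel (G k) => (diameter R e <= 2%:E)%E))).
    apply: prob_le2_isotone; [by case/andP: (p01 k)|by near: k|].
    by near: k; apply: crit1.
  have f1 : 1 < fG (G k) (c - eps / 2).
    have : 2 <= fG (G k) (c - eps / 2) by near: k.
    lra.
  by move: f1; near: k; apply: le2; lra.
apply/cvgrPdist_le => tol tol0.
have [_ /cvgrPdist_le /(_ 1 ltr01) f1] := cond (eps / 2) ltac:(lra).
have ce0 : 0 < c + eps by lra.
near=> k.
rewrite -cayley_prob_gt2 ger0_norm; last by apply: prob_gt2_ge0.
apply: (@le_trans _ _ (cayley_prob (crit (c + eps) k)
    (fun e : rel (G k) => (2%:E < diameter R e)%E))).
  apply: prob_gt2_antitone => //; [by near: k|by case/andP: (p01 k)].
have fk : fG (G k) (c + eps / 2) <= 1.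
  have : `|0 - fG (G k) (c + eps / 2)| <= 1 by near: k.
  by rewrite ler_norml => /andP[h _]; lra.
by move: fk; near: k; apply: gt2; lra.
Unshelve. all: by end_near.
Qed.
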